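(* For an ultra-Noetherian local ring $R_\natural$, we have inequalities $$\operatorname{depth}(R_\natural)\leq\operatorname{pidim}(R_\natural)=\operatorname{frdim}(R_\natural)=\operatorname{udim}(R_\natural)\leq\operatorname{cldim}(R_\natural)=\operatorname{gdim}(R_\natural)=\operatorname{cdim}(R_\natural)\leq\operatorname{embdim}(R_\natural).$$
   Context: Local rings are not assumed Noetherian; $\operatorname{embdim}$ is the minimal number of generators of the maximal ideal. Fix an infinite index set $W$ with a countably incomplete non-principal ultrafilter; ''almost all $w$'' means for all $w$ in a member of the ultrafilter. An ultra-Noetherian local ring $(R_\natural,\mathfrak m_\natural)$ is an ultraproduct of Noetherian local rings $(R_w,\mathfrak m_w)$ of bounded embedding dimension (i.e. for some $m$ almost all $R_w$ have embedding dimension at most $m$). The ultra-dimension $\operatorname{udim}(R_\natural)$ is the common Krull dimension of almost all $R_w$. For a local ring $(R,\mathfrak m)$ of finite embedding dimension: - The depth is the grade of $\mathfrak m$: if $\mathfrak m$ is generated by $\mathbf x=(x_1,\dots,x_n)$ and $h$ is the largest $i$ with Koszul homology $H_i(\mathbf x;R)\neq0$, then $\operatorname{depth}(R)=n-h$. - An associated prime of an ideal $J$ is a prime ideal of the form $(J:a)$; a minimal associated prime of $J$ is an associated prime $\mathfrak p$ of $J$ such that no associated prime of $J$ is properly contained in $\mathfrak p$. $\operatorname{pidim}(R)$ is the least $d$ such that $\mathfrak m$ is a minimal associated prime of an ideal generated by $d$ elements. - $\operatorname{frdim}(R)$ is the supremum of lengths of proper chains of prime ideals each of which is finitely related, i.e.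 of the form $(I:a)$ with $I$ a finitely generated ideal. - $\operatorname{cldim}(R)$ is the supremum of lengths of proper chains of prime ideals that are closed in the $\mathfrak m$-adic topology. - $\operatorname{gdim}(R)$, the geometric dimension, is the least number of elements of $\mathfrak m$ generating an ideal $I$ with $R/I$ Artinian. - $\operatorname{cdim}(R)$ is the Krull dimension of the completion $\widehat R=\varprojlim R/\mathfrak m^n$. *)

(* Defs.v *)
From HB Require Import structures.
From mathcomp Require Import all_boot all_order all_algebra.
From mathcomp Require Import generic_quotient ring_quotient.
From mathcomp Require Import boolp classical_sets functions cardinality filter.

Set Implicit Arguments.
Unset Strict Implicit.
Unset Printing Implicit Defensive.

Import GRing.Theory.
Local Open Scope classical_set_scope.
Local Open Scope ring_scope.
Local Open Scope quotient_scope.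

(* Extended natural numbers: [None] stands for infinity. *)
Definition enat := option nat.

Definition enat_le (x y : enat) : Prop :=
  match x, y with
  | _, None => True
  | None, Some _ => False
  | Some a, Some b => (a <= b)%N
  end.

(* The least element of [A]; infinity when [A] is empty. *)
Definition enat_min (A : set nat) : enat :=
  if pselect (exists n, `[< A n >]) is left exA then Some (ex_minn exA)
  else None.

(* The supremum of [A], i.e. its least natural upper bound if it has one. *)
Definition enat_sup (A : set nat) : enat :=
  enat_min [set n | forall k, A k -> (k <= n)%N].

(* [idealr] of [ring_quotient] is restricted to proper ideals; the unit ideal
   is needed here, e.g. for [(I : a)] with [a \in I]. *)
Section Ideals.
Variable R : comNzRingType.
Implicit Types (I J P M : set R) (S : set R).

Definition ideal I : Prop :=
  [/\ I 0, forall x y, I x -> I y -> I (x + y) & forall a x, I x -> I (a * x)].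

Definition pideal I : Prop := ideal I /\ ~ I 1.

Definition prime_ideal P : Prop :=
  pideal P /\ forall x y, P (x * y) -> P x \/ P y.

Definition maximal_ideal M : Prop :=
  pideal M /\ forall I, pideal I -> M `<=` I -> I = M.

Definition ideal_gen S : set R := smallest ideal S.

Definition ideal_pow I n : set R :=
  ideal_gen [set \prod_(i < n) x i | x in [set x : 'I_n -> R | forall i, I (x i)]].

Definition colon I (a : R) : set R := [set x | I (x * a)].

Definition generated_by n I : Prop :=
  exists x : 'I_n -> R, I = ideal_gen (range x).

Definition fin_gen I : Prop := exists n, generated_by n I.

Definition noetherian : Prop := forall I, ideal I -> fin_gen I.

Definition artinian : Prop :=
  forall I : nat -> set R, (forall n, ideal (I n)) ->
    (forall n, I n.+1 `<=` I n) ->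
    exists n, forall k, (n <= k)%N -> I k = I n.

Definition associated_prime J P : Prop :=
  prime_ideal P /\ exists a, P = colon J a.

Definition minimal_associated_prime J P : Prop :=
  associated_prime J P /\ forall Q, associated_prime J Q -> ~ Q `<` P.

Definition finitely_related I : Prop :=
  exists J a, fin_gen J /\ I = colon J a.

(* Open and closed sets of the [I]-adic topology: the cosets [x + I^n] form a
   basis of neighbourhoods of [x]. *)
Definition adic_open I S : Prop :=
  forall x, S x -> exists n, forall y, ideal_pow I n y -> S (x + y).

Definition adic_closed I S : Prop := adic_open I (~` S).

Definition prime_chain (C : set R -> Prop) n : Prop :=
  exists p : nat -> set R,
    (forall i, (i <= n)%N -> prime_ideal (p i) /\ C (p i)) /\
    (forall i, (i < n)%N -> p i `<` p i.+1).

Definition chain_dim (C : set R -> Prop) : enat := enat_sup (prime_chain C).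

Definition krull_dim : enat := chain_dim (fun _ => True).

Lemma ideal_gen_ideal S : ideal (ideal_gen S).
Proof.
split=> [|x y Sx Sy|a x Sx] I SI; case: (SI) => -[I0 ID IM] _ //.
- by apply: ID; [apply: Sx | apply: Sy].
- by apply: IM; apply: Sx.
Qed.

Lemma ideal_pow_sub I n : ideal I -> ideal_pow I n.+1 `<=` I.
Proof.
move=> II; apply: smallest_sub => // _ [x Ix <-].
by rewrite big_ord_recl mulrC; case: II => _ _; apply.
Qed.

Lemma pideal_pow I n : pideal I -> pideal (ideal_pow I n.+1).
Proof.
by case=> II I1; split; [exact: ideal_gen_ideal | move/(ideal_pow_sub II)].
Qed.

Lemma pideal_sub_maximal I : pideal I -> exists2 M, maximal_ideal M & I `<=` M.
Proof.
move=> pI; pose P A := A = set0 \/ pideal A /\ I `<=` A.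
have [F FP totF|M [PM Mmax]] := @Zorn_bigcup R P.
  have [[A FA [pA IA]]|no] :=
      pselect (exists2 A, F A & pideal A /\ I `<=` A); last first.
    left; apply/seteqP; split=> // x [A FA Ax].
    by case: (FP _ FA) => [A0|pA]; [rewrite A0 in Ax | case: no; exists A].
  have FI X x : F X -> X x -> pideal X by move=> /FP [->|[]].
  right; split; last by move=> x /IA Ax; exists A.
  split; last by move=> [X FX X1]; case: (FI _ _ FX X1).
  split.
  - by exists A => //; case: pA => -[].
  - move=> x y [X FX Xx] [Y FY Yy].
    case: (totF _ _ FX FY) => XY.
      by exists Y => //; case: (FI _ _ FY Yy) => -[_ D _] _; apply: D; auto.
    by exists X => //; case: (FI _ _ FX Xx) => -[_ D _] _; apply: D; auto.
  - move=> a x [X FX Xx]; exists X => //.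
    by case: (FI _ _ FX Xx) => -[_ _ D] _; apply: D.
have [M0|[pM IM]] := PM.
  exfalso; apply: (Mmax I); last by right; split.
  rewrite M0; split=> [x []|I0].
  by apply: (I0 0); case: pI => -[].
exists M => //; split=> // J pJ MJ; apply: contrapT => JM.
apply: (Mmax J); last by right; split=> //; exact: subset_trans MJ.
by split=> // JM'; apply: JM; apply/seteqP.
Qed.

Lemma pideal_principal (x : R) :
  (forall y, y * x <> 1) -> pideal [set y * x | y in setT].
Proof.
move=> xN; split; last by case=> y _ /xN.
split; first by exists 0 => //; rewrite mul0r.
  by move=> _ _ [a _ <-] [b _ <-]; exists (a + b) => //; rewrite mulrDl.
by move=> a _ [b _ <-]; exists (a * b) => //; rewrite mulrA.
Qed.

End Ideals.

(* The phantom proof that the index type is inhabited makes the product a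
   nonzero ring. *)
Definition dprod (T : Type) (inh : inhabited T) (R : T -> comNzRingType) :=
  forall t, R t.

Section ProductRing.
Variables (T : Type) (inh : inhabited T) (R : T -> comNzRingType).
Local Notation P := (dprod inh R).
Implicit Types f g h : P.

HB.instance Definition _ := gen_eqMixin P.
HB.instance Definition _ := gen_choiceMixin P.

Let add f g : P := fun t => f t + g t.
Let opp f : P := fun t => - f t.
Let zero : P := fun t => 0.
Let one : P := fun t => 1.
Let mul f g : P := fun t => f t * g t.

Let addA : associative add.
Proof. by move=> f g h; apply: functional_extensionality_dep => t; apply: addrA. Qed.
Let addC : commutative add.
Proof. by move=> f g; apply: functional_extensionality_dep => t; apply: addrC. Qed.
Let add0 : left_id zero add.
Proof. by move=> f; apply: functional_extensionality_dep => t; apply: add0r. Qed.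
Let addN : left_inverse zero opp add.
Proof. by move=> f; apply: functional_extensionality_dep => t; apply: addNr. Qed.
Let mulA : associative mul.
Proof. by move=> f g h; apply: functional_extensionality_dep => t; apply: mulrA. Qed.
Let mulC : commutative mul.
Proof. by move=> f g; apply: functional_extensionality_dep => t; apply: mulrC. Qed.
Let mul1 : left_id one mul.
Proof. by move=> f; apply: functional_extensionality_dep => t; apply: mul1r. Qed.
Let mulD : left_distributive mul add.
Proof. by move=> f g h; apply: functional_extensionality_dep => t; apply: mulrDl. Qed.
Let one_neq0 : one != zero.
Proof.
case: inh => t; apply/eqP => /(congr1 (fun f : P => f t)) /eqP.
by rewrite oner_eq0.
Qed.

HB.instance Definition _ := GRing.isZmodule.Build P addA addC add0 addN.
HB.instance Definition _ :=
  GRing.Zmodule_isComNzRing.Build P mulA mulC mul1 mulD one_neq0.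

End ProductRing.

Definition pideal_pred (R : comNzRingType) (I : set R) (HI : pideal I)
  : R -> bool := fun x => `[< I x >].

Section QuotientRing.
Variables (R : comNzRingType) (I : set R) (HI : pideal I).

Let pideal_pred_closed : idealr_closed (pideal_pred HI).
Proof.
case: (HI) => -[I0 ID IM] I1; split.
- exact/asboolP.
- by apply/negP => /asboolP.
- move=> a x y /asboolP Ix /asboolP Iy; apply/asboolP.
  by apply: ID => //; apply: IM.
Qed.

HB.instance Definition _ := isIdealr.Build R (pideal_pred HI) pideal_pred_closed.

Definition pideal_idealr : idealr R := pideal_pred HI.

Definition quot_ring : comNzRingType := {ideal_quot pideal_idealr}.

Definition quot_pi (x : R) : quot_ring := \pi_{ideal_quot pideal_idealr} x.

Lemma quot_piE x y : quot_pi x = quot_pi y <-> I (x - y).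
Proof.
split=> [/eqP|H]; last (apply/eqP).
  by rewrite /quot_pi -Quotient.idealrBE => /asboolP.
by rewrite /quot_pi -Quotient.idealrBE; apply/asboolP.
Qed.

Lemma quot_pi_surj z : exists x, z = quot_pi x.
Proof. by exists (repr z); rewrite /quot_pi reprK. Qed.

Lemma quot_piM x y : quot_pi (x * y) = quot_pi x * quot_pi y.
Proof. exact: rmorphM. Qed.

Lemma quot_piD x y : quot_pi (x + y) = quot_pi x + quot_pi y.
Proof. exact: rmorphD. Qed.

Lemma quot_piB x y : quot_pi (x - y) = quot_pi x - quot_pi y.
Proof. exact: rmorphB. Qed.

Lemma quot_pi1 : quot_pi 1 = 1.
Proof. exact: rmorph1. Qed.

Lemma quot_pi0 : quot_pi 0 = 0.
Proof. exact: rmorph0. Qed.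

End QuotientRing.

Record localRing := LocalRing {
  local_ring :> comNzRingType;
  maxid : set local_ring;
  maxid_maximal : maximal_ideal maxid;
  maxid_unique : forall M : set local_ring, maximal_ideal M -> M = maxid }.
Arguments maxid : clear implicits.

Lemma local_inv (R : localRing) (x : R) : ~ maxid R x -> exists y, y * x = 1.
Proof.
move=> xm; apply: contrapT => xN; apply: xm.
have [|M /maxid_unique <-] := @pideal_sub_maximal R [set y * x | y in setT].
  by apply: pideal_principal => y yx; apply: xN; exists y.
by apply; exists 1 => //; rewrite mul1r.
Qed.

(* The inverse limit of the [R / m^(n+1)]; the trivial ring [R / m^0] is left
   out. *)
Section Completion.
Variable R : localRing.

Definition adic_quot (n : nat) : comNzRingType :=
  quot_ring (pideal_pow n (maxid_maximal R).1).

Definition adic_pi (n : nat) : R -> adic_quot n :=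
  quot_pi (pideal_pow n (maxid_maximal R).1).

Definition adic_prod : comNzRingType := dprod (inhabits 0%N) adic_quot.

(* [x n] is the image of [x n.+1] under the projection
   [R / m^(n+2) -> R / m^(n+1)]. *)
Definition compatible (x : adic_prod) : bool :=
  `[< forall n, exists r : R, x n.+1 = adic_pi n.+1 r /\ x n = adic_pi n r >].

Let compatible_closed : subring_closed compatible.
Proof.
split.
- by apply/asboolP => n; exists 1; split; rewrite /adic_pi quot_pi1.
- move=> x y /asboolP Cx /asboolP Cy; apply/asboolP => n.
  have [r [rx rx']] := Cx n; have [s [sy sy']] := Cy n.
  by exists (r - s); split; rewrite /adic_pi quot_piB; congr (_ - _).
- move=> x y /asboolP Cx /asboolP Cy; apply/asboolP => n.
  have [r [rx rx']] := Cx n; have [s [sy sy']] := Cy n.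
  by exists (r * s); split; rewrite /adic_pi quot_piM; congr (_ * _).
Qed.

HB.instance Definition _ :=
  GRing.isSubringClosed.Build adic_prod compatible compatible_closed.

Definition completion := {x : adic_prod | compatible x}.

HB.instance Definition _ := SubChoice.on completion.
HB.instance Definition _ := [SubChoice_isSubComNzRing of completion by <:].

End Completion.

(* The Koszul complex of [x_0, ..., x_(n-1)] is free on the [e_S], with [S] a
   subset of ['I_n]; [e_S] has degree [#|S|], and
     [d e_S = \sum_(j in S) (-1)^#|{k in S | k < j}| x_j e_(S \ j)].
   Below, [c] is the element [\sum_S c S e_S]. *)
Section Koszul.
Variables (R : comNzRingType) (n : nat) (x : 'I_n -> R).
Implicit Types b c : {ffun {set 'I_n} -> R}.

Definition koszul_d c : {ffun {set 'I_n} -> R} :=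
  [ffun S : {set 'I_n} => \sum_(j | j \notin S)
     (-1) ^+ #|[set k in S | (k < j)%N]| * x j * c (j |: S)%SET].

Definition koszul_degree i c : Prop := forall S, c S != 0 -> #|S| = i.

Definition koszul_cycle i c : Prop := koszul_degree i c /\ koszul_d c = 0.

Definition koszul_boundary i c : Prop :=
  exists2 b, koszul_degree i.+1 b & c = koszul_d b.

Definition koszul_homology_neq0 i : Prop :=
  exists c, koszul_cycle i c /\ ~ koszul_boundary i c.

End Koszul.

Section Invariants.
Variable R : localRing.
Local Notation m := (maxid R).

Definition embdim : enat := enat_min [set d | generated_by d m].

(* [n - h] does not depend on the choice of the generating tuple [x]; if [m] is
   not finitely generated, the value is the default [0]. *)
Definition depth : nat :=
  xget 0%N [set d | exists n (x : 'I_n -> R) h,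
    [/\ m = ideal_gen (range x),
        koszul_homology_neq0 x h,
        forall i, koszul_homology_neq0 x i -> (i <= h)%N &
        d = (n - h)%N]].

Definition pidim : enat :=
  enat_min [set d | exists2 J, generated_by d J & minimal_associated_prime J m].

Definition frdim : enat := chain_dim (@finitely_related R).

Definition cldim : enat := chain_dim (adic_closed m).

Definition gdim : enat :=
  enat_min [set d | exists (x : 'I_d -> R) (HI : pideal (ideal_gen (range x))),
    (forall i, m (x i)) /\ artinian (quot_ring HI)].

Definition cdim : enat := krull_dim (completion R).

End Invariants.

Section Ultraproduct.
Variables (W : Type) (U : set_system W) (HU : UltraFilter U).
Variable R : W -> localRing.

Let inhW : inhabited W.
Proof. by have [w _] := filter_ex (@filterT _ U _); exists. Qed.

Definition ultra_prod : comNzRingType :=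
  dprod inhW (fun w => R w : comNzRingType).

Definition almost_zero : set ultra_prod := [set f | \forall w \near U, f w = 0].

Lemma almost_zero_pideal : pideal almost_zero.
Proof.
split; last first.
  move=> H; have [w /eqP] := filter_ex H.
  by rewrite oner_eq0.
split.
- exact: nearW.
- by move=> f g; apply: filterS2 => w f0 g0; rewrite [LHS](_ : _ = f w + g w)// f0 g0 addr0.
- by move=> a f; apply: filterS => w f0; rewrite [LHS](_ : _ = a w * f w)// f0 mulr0.
Qed.

Definition ultra_ring : comNzRingType := quot_ring almost_zero_pideal.

Definition ultra_class (f : ultra_prod) : ultra_ring :=
  quot_pi almost_zero_pideal f.

Definition ultra_maxid : set ultra_ring :=
  [set ultra_class f | f in [set f | \forall w \near U, maxid (R w) (f w)]].

Lemma ultra_maxidE f :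
  ultra_maxid (ultra_class f) <-> \forall w \near U, maxid (R w) (f w).
Proof.
split=> [[g gm] /quot_piE gf|fm]; last by exists f.
apply: filterS2 gm gf => w gw.
by rewrite [X in X = _](_ : _ = g w - f w)// => /eqP; rewrite subr_eq0 => /eqP <-.
Qed.

Lemma ultra_inv z : ~ ultra_maxid z -> exists y, y * z = 1.
Proof.
have [f ->] := quot_pi_surj z => fm.
have {}fm : \forall w \near U, ~ maxid (R w) (f w).
  have [Uf|//] := in_ultra_setVsetC [set w | maxid (R w) (f w)] HU.
  by case: fm; apply/ultra_maxidE.
have Hg w : exists y : R w, ~ maxid (R w) (f w) -> y * f w = 1.
  have [/local_inv[y yf]|fw] := pselect (~ maxid (R w) (f w)); first by exists y.
  by exists 0.
pose g : ultra_prod := fun w => projT1 (cid (Hg w)).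
exists (ultra_class g); rewrite /ultra_class -quot_piM -quot_pi1; apply/quot_piE.
apply: filterS fm => w fw; rewrite [LHS](_ : _ = g w * f w - 1)// /g.
by case: cid => y /= ->; rewrite ?subrr.
Qed.

Lemma ultra_maxid_pideal : pideal ultra_maxid.
Proof.
split; last first.
  rewrite -(quot_pi1 almost_zero_pideal) => /ultra_maxidE H.
  by have [w] := filter_ex H; case: (maxid_maximal (R w)).1.
split.
- rewrite -(quot_pi0 almost_zero_pideal); apply/ultra_maxidE.
  by apply: nearW => w; case: (maxid_maximal (R w)).1 => -[].
- move=> _ _ [f fm <-] [g gm <-]; rewrite /ultra_class -quot_piD.
  apply/ultra_maxidE; apply: filterS2 fm gm => w.
  by case: (maxid_maximal (R w)).1 => -[_ D _] _; apply: D.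
- move=> a _ [f fm <-]; have [b ->] := quot_pi_surj a.
  rewrite /ultra_class -quot_piM; apply/ultra_maxidE.
  apply: filterS fm => w.
  by case: (maxid_maximal (R w)).1 => -[_ _ D] _; apply: D.
Qed.

Lemma pideal_sub_ultra_maxid I : pideal I -> I `<=` ultra_maxid.
Proof.
case=> -[_ _ IM] I1 z Iz; apply: contrapT => /ultra_inv[y yz].
by apply: I1; rewrite -yz; apply: IM.
Qed.

Lemma ultra_maxid_maximal : maximal_ideal ultra_maxid.
Proof.
split=> [|I pI mI]; first exact: ultra_maxid_pideal.
by apply/seteqP; split=> //; apply: pideal_sub_ultra_maxid.
Qed.

Lemma ultra_maxid_unique M : maximal_ideal M -> M = ultra_maxid.
Proof.
case=> pM Mmax; apply/esym/Mmax; first exact: ultra_maxid_pideal.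
exact: pideal_sub_ultra_maxid.
Qed.

Definition ultraproduct : localRing :=
  LocalRing ultra_maxid_maximal ultra_maxid_unique.

(* The value taken by [krull_dim (R w)] for almost all [w]; it is unique if it
   exists, and the default is infinity. *)
Definition udim : enat :=
  xget None [set d | \forall w \near U, krull_dim (R w) = d].

End Ultraproduct.

Definition nonprincipal (W : Type) (U : set_system W) : Prop :=
  forall w, ~ U [set w].

Definition countably_incomplete (W : Type) (U : set_system W) : Prop :=
  exists A : nat -> set W, (forall n, U (A n)) /\ ~ U (\bigcap_n A n).

(* Main.v *)
Require Import Defs.
From mathcomp Require Import all_boot all_order all_algebra.
From mathcomp Require Import ring.
From mathcomp Require Import boolp classical_sets functions cardinality filter.

(* By the theorem of Los, ideals generated by [n] elements, colon ideals and
   powers of the maximal ideal of the ultraproduct [Rn] are computed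
   componentwise.  So [pidim] and [frdim] are read off the Noetherian components,
   where a prime of height at most [d] is minimal over, hence associated to, an
   ideal with [d] generators, and where by Krull's height theorem the maximal
   ideal is not minimal over fewer than [dim] elements.  The depth is at most
   the dimension in the components, as one sees by dividing by regular elements
   until the socle is nonzero, and nonvanishing Koszul homology passes to [Rn].

   Countable incompleteness of the ultrafilter gives saturation: [Rn] is
   quasi-complete, so its completion is the quotient by the infinitesimals
   [\bigcap_k m^k] and finitely generated ideals of the completion are closed.
   Hence the completion is Noetherian (as for power series, by looking at leading
   coefficients), its primes are the closed primes of [Rn], and its dimension is
   the least number of parameters.  By Nakayama parameters lift to [Rn], and by
   the theorem of Los parameters of [Rn] are parameters in almost all components. *)

Set Implicit Arguments.
Unset Strict Implicit.
Unset Printing Implicit Defensive.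

Import GRing.Theory.
Local Open Scope classical_set_scope.
Local Open Scope ring_scope.

(** [Rn] is in general not Noetherian, and the theorem of Los reaches only internal sets, the
    ultraproducts [uset I] of subsets of the components. Finitely generated ideals are internal, but
    an internal ideal is finitely generated only if the number of generators is bounded in almost
    all components. Hence the same [d] generators for all primes of a chain, and hence associated
    primes: [(J : a)] with [J] finitely generated is internal, which an arbitrary prime over [J]
    need not be. The infinitesimals are in general not internal; closed primes contain them, so
    [cldim] sees only the completion. The middle inequality is one-sided because an inclusion of
    [m^n] in [(x)] passes from [Rn] to the components with the same [n], while the exponents that
    belong to parameters of the components may be unbounded. Localizations are never formed: a
    statement over [A_P] is one over [A] up to a factor outside [P]. *)

Section IdealTheory.
Variable A : comNzRingType.
Implicit Types (I J K M N P Q : set A).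

Lemma ideal0 I : ideal I -> I 0. Proof. by case. Qed.

Lemma idealD I x y : ideal I -> I x -> I y -> I (x + y).
Proof. by case=> _ ID _; apply: ID. Qed.

Lemma ideal_mull I a x : ideal I -> I x -> I (a * x).
Proof. by case=> _ _ IM; apply: IM. Qed.

Lemma ideal_mulr I a x : ideal I -> I x -> I (x * a).
Proof. by rewrite mulrC; apply: ideal_mull. Qed.

Lemma idealN I x : ideal I -> I x -> I (- x).
Proof. by move=> II Ix; rewrite -mulN1r; apply: ideal_mull. Qed.

Lemma idealB I x y : ideal I -> I x -> I y -> I (x - y).
Proof. by move=> II Ix Iy; apply: idealD => //; apply: idealN. Qed.

Lemma ideal_sum I (T : Type) (r : seq T) (p : pred T) (F : T -> A) :
  ideal I -> (forall i, p i -> I (F i)) -> I (\sum_(i <- r | p i) F i).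
Proof.
by move=> II IF; elim/big_ind: _ => //; [apply: ideal0|move=> x y; apply: idealD].
Qed.

Arguments ideal_mull {I a x}.
Arguments ideal_mulr {I a x}.
Arguments ideal_sum {I T r p F}.

Lemma ideal_zero : ideal [set (0 : A)].
Proof.
split=> //= [x y -> ->|a x ->]; by rewrite ?addr0 ?mulr0.
Qed.

Lemma prime_idealW P : prime_ideal P -> ideal P. Proof. by case=> -[]. Qed.

Lemma prime1 P : prime_ideal P -> ~ P 1. Proof. by case=> -[]. Qed.

Lemma primeNM P x y : prime_ideal P -> ~ P x -> ~ P y -> ~ P (x * y).
Proof. by move=> [_ PP] Px Py /PP[]. Qed.

Lemma primeM P x y : prime_ideal P -> P (x * y) -> ~ P x -> P y.
Proof. by move=> [_ PP] /PP[]. Qed.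

Lemma prime_exp P x n : prime_ideal P -> P (x ^+ n) -> P x.
Proof.
move=> PP; elim: n => [|n IH]; first by rewrite expr0 => /(prime1 PP).
by rewrite exprS => /PP.2[].
Qed.

Lemma ideal_gen_sub (S : set A) : S `<=` ideal_gen S.
Proof. exact: sub_smallest. Qed.

Lemma ideal_gen_smallest (S : set A) I : ideal I -> S `<=` I -> ideal_gen S `<=` I.
Proof. exact: smallest_sub. Qed.

Lemma ideal_gen_rangeP n (x : 'I_n -> A) y :
  ideal_gen (range x) y <-> exists c : 'I_n -> A, y = \sum_i c i * x i.
Proof.
split=> [|[c ->]]; last first.
  apply: (ideal_sum (ideal_gen_ideal _)) => i _.
  by apply: (ideal_mull (ideal_gen_ideal _)); apply: ideal_gen_sub; exists i.
pose I := [set y | exists c : 'I_n -> A, y = \sum_i c i * x i].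
apply: (@ideal_gen_smallest _ I).
  split.
  - by exists (fun=> 0); rewrite big1 // => i _; rewrite mul0r.
  - move=> _ _ [c ->] [d ->]; exists (fun i => c i + d i).
    by rewrite -big_split /=; apply: eq_bigr => i _; rewrite mulrDl.
  - move=> a _ [c ->]; exists (fun i => a * c i).
    by rewrite mulr_sumr; apply: eq_bigr => i _; rewrite mulrA.
move=> _ [i _ <-]; exists (fun j => (j == i)%:R).
rewrite (bigD1 i) //= eqxx mul1r big1 ?addr0 // => j /negPf ->.
by rewrite mul0r.
Qed.

Lemma ideal_gen_range n (x : 'I_n -> A) i : ideal_gen (range x) (x i).
Proof. by apply: ideal_gen_sub; exists i. Qed.

Lemma ideal_gen_range_sub n (x : 'I_n -> A) I :
  ideal I -> (forall i, I (x i)) -> ideal_gen (range x) `<=` I.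
Proof. by move=> II Ix; apply: ideal_gen_smallest => // _ [i _ <-]. Qed.

Definition iadd I J : set A := [set z | exists a b, [/\ I a, J b & z = a + b]].

Definition princ (x : A) : set A := [set z | exists c, z = c * x].

Definition iprod I J : set A := ideal_gen [set z | exists a b, [/\ I a, J b & z = a * b]].

Lemma iadd_ideal I J : ideal I -> ideal J -> ideal (iadd I J).
Proof.
move=> II IJ; split.
- by exists 0, 0; rewrite addr0; split=> //; apply: ideal0.
- move=> _ _ [a [b [Ia Jb ->]]] [a' [b' [Ia' Jb' ->]]]; exists (a + a'), (b + b').
  by rewrite addrACA; split=> //; apply: idealD.
- move=> c _ [a [b [Ia Jb ->]]]; exists (c * a), (c * b).
  by rewrite mulrDr; split=> //; apply: ideal_mull.
Qed.

Lemma iadd_subl I J : ideal J -> I `<=` iadd I J.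
Proof. by move=> IJ x Ix; exists x, 0; rewrite addr0; split=> //; apply: ideal0. Qed.

Lemma iadd_subr I J : ideal I -> J `<=` iadd I J.
Proof. by move=> IJ x Ix; exists 0, x; rewrite add0r; split=> //; apply: ideal0. Qed.

Lemma iadd_sub I J K : ideal K -> I `<=` K -> J `<=` K -> iadd I J `<=` K.
Proof. by move=> IK sI sJ _ [a [b [/sI ? /sJ ? ->]]]; apply: idealD. Qed.

Lemma princ_ideal x : ideal (princ x).
Proof.
split.
- by exists 0; rewrite mul0r.
- by move=> _ _ [a ->] [b ->]; exists (a + b); rewrite mulrDl.
- by move=> a _ [b ->]; exists (a * b); rewrite mulrA.
Qed.

Lemma princ_id x : princ x x. Proof. by exists 1; rewrite mul1r. Qed.

Lemma princ_sub I x : ideal I -> I x -> princ x `<=` I.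
Proof. by move=> II Ix _ [c ->]; apply: ideal_mull. Qed.

Lemma iprod_ideal I J : ideal (iprod I J).
Proof. exact: ideal_gen_ideal. Qed.

Lemma iprod_mem I J a b : I a -> J b -> iprod I J (a * b).
Proof. by move=> Ia Jb; apply: ideal_gen_sub; exists a, b. Qed.

Lemma iprodC I J : iprod I J = iprod J I.
Proof.
rewrite /iprod; congr ideal_gen; apply/seteqP; split=> _ [a [b [Ia Jb ->]]];
  by exists b, a; rewrite mulrC.
Qed.

Lemma iprod_sub I J K : ideal K -> (forall a b, I a -> J b -> K (a * b)) -> iprod I J `<=` K.
Proof. by move=> IK H; apply: ideal_gen_smallest => // _ [a [b [Ia Jb ->]]]; apply: H. Qed.

Lemma iprod_subr I J : ideal J -> iprod I J `<=` J.
Proof. by move=> IJ; apply: iprod_sub => // a b _ Jb; apply: ideal_mull. Qed.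

Lemma iprod_subl I J : ideal I -> iprod I J `<=` I.
Proof. by move=> IJ; apply: iprod_sub => // a b Ia _; apply: ideal_mulr. Qed.

Lemma iprod_genP n (x : 'I_n -> A) I y : ideal I ->
  iprod I (ideal_gen (range x)) y <->
  exists2 c : 'I_n -> A, (forall i, I (c i)) & y = \sum_i c i * x i.
Proof.
move=> II; split=> [|[c Ic ->]]; last first.
  apply: (ideal_sum (iprod_ideal _ _)) => i _.
  by apply: iprod_mem => //; apply: ideal_gen_range.
pose K := [set y | exists2 c : 'I_n -> A, (forall i, I (c i)) & y = \sum_i c i * x i].
apply: (@iprod_sub _ _ K).
  split.
  - by exists (fun=> 0) => [i|]; [exact: ideal0|rewrite big1 // => i _; rewrite mul0r].
  - move=> _ _ [c Ic ->] [d Id ->]; exists (fun i => c i + d i).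
      by move=> i; apply: idealD.
    by rewrite -big_split /=; apply: eq_bigr => i _; rewrite mulrDl.
  - move=> a _ [c Ic ->]; exists (fun i => a * c i); first by move=> i; apply: ideal_mull.
    by rewrite mulr_sumr; apply: eq_bigr => i _; rewrite mulrA.
move=> a b Ia /ideal_gen_rangeP[c ->]; exists (fun i => a * c i).
  by move=> i; apply: ideal_mulr.
by rewrite mulr_sumr; apply: eq_bigr => i _; rewrite mulrA.
Qed.

Lemma ideal_pow0 I : ideal_pow I 0 = setT.
Proof.
apply/seteqP; split=> // y _; rewrite -(mulr1 y); apply: (ideal_mull (ideal_gen_ideal _)).
by apply: ideal_gen_sub; exists (fun=> 0) => [[]//|]; rewrite big_ord0.
Qed.

Lemma ideal_pow_ideal I n : ideal (ideal_pow I n).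
Proof. exact: ideal_gen_ideal. Qed.

Lemma ideal_powS I n : ideal_pow I n.+1 = iprod I (ideal_pow I n).
Proof.
apply/seteqP; split.
  apply: ideal_gen_smallest; first exact: iprod_ideal.
  move=> _ [x Ix <-]; rewrite big_ord_recl; apply: iprod_mem => //.
  by apply: ideal_gen_sub; exists (fun i => x (lift ord0 i)) => // i; apply: Ix.
apply: iprod_sub; first exact: ideal_pow_ideal.
move=> a b Ia; move: b; pose K := [set b | ideal_pow I n.+1 (a * b)].
apply: (@ideal_gen_smallest _ K).
  split.
  - by rewrite /K /= mulr0; apply: ideal0 (ideal_pow_ideal _ _).
  - by move=> x y; rewrite /K /= mulrDr; apply: idealD (ideal_pow_ideal _ _).
  - by move=> c x; rewrite /K /= mulrCA; apply: ideal_mull (ideal_pow_ideal _ _).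
move=> _ [x Ix <-]; rewrite /K /=; apply: ideal_gen_sub.
exists (fun i => oapp x a (unlift ord0 i)).
  by move=> i; case: unliftP => [j|] _ //=; apply: Ix.
rewrite big_ord_recl unlift_none /=; congr (_ * _).
by apply: eq_bigr => i _; rewrite liftK.
Qed.

Lemma ideal_powS_sub I n : ideal_pow I n.+1 `<=` ideal_pow I n.
Proof. by rewrite ideal_powS; apply: iprod_subr; apply: ideal_pow_ideal. Qed.

Lemma ideal_pow_leq I m n : (m <= n)%N -> ideal_pow I n `<=` ideal_pow I m.
Proof.
move=> /subnK <-; elim: (n - m)%N => [//|k IH].
by rewrite addSn; apply: subset_trans IH; apply: ideal_powS_sub.
Qed.

Lemma ideal_pow1 I : ideal I -> ideal_pow I 1 = I.
Proof.
move=> II; rewrite ideal_powS ideal_pow0; apply/seteqP; split.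
  by apply: iprod_subl.
by move=> x Ix; rewrite -(mulr1 x); apply: iprod_mem.
Qed.

Lemma ideal_pow_exp I x n : I x -> ideal_pow I n (x ^+ n).
Proof.
move=> Ix; elim: n => [|n IH]; first by rewrite ideal_pow0.
by rewrite exprS ideal_powS; apply: iprod_mem.
Qed.

Lemma prime_pow P I n : prime_ideal P -> ideal_pow I n `<=` P -> I `<=` P.
Proof. by move=> PP s x Ix; apply: (prime_exp PP (n := n)); apply: s; apply: ideal_pow_exp. Qed.

Lemma colon_ideal I a : ideal I -> ideal (colon I a).
Proof.
move=> II; split=> [|x y|c x]; rewrite /colon /=.
- by rewrite mul0r; apply: ideal0.
- by rewrite mulrDl; apply: idealD.
- by rewrite -mulrA; apply: ideal_mull.
Qed.

Lemma colon_sub I a : ideal I -> I `<=` colon I a.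
Proof. by move=> II x Ix; apply: ideal_mulr. Qed.

Lemma colonM I a b : colon (colon I a) b = colon I (b * a).
Proof. by apply/seteqP; split=> x; rewrite /colon /= mulrA. Qed.

Lemma fin_gen_gen n (x : 'I_n -> A) : fin_gen (ideal_gen (range x)).
Proof. by exists n, x. Qed.

Lemma fin_gen_iadd I J : fin_gen I -> fin_gen J -> fin_gen (iadd I J).
Proof.
move=> [m [x ->]] [n [y ->]]; exists (m + n)%N.
pose z (i : 'I_(m + n)) := match fintype.split i with inl j => x j | inr j => y j end.
have zl i : z (lshift n i) = x i.
  by rewrite /z; case: split_ordP => j => [/lshift_inj ->|/eqP]; rewrite ?eq_lrshift.
have zr i : z (rshift m i) = y i.
  by rewrite /z; case: split_ordP => j => [/eqP|/rshift_inj ->]; rewrite ?eq_rlshift.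
exists z; apply/seteqP; split.
  apply: iadd_sub; first exact: ideal_gen_ideal.
    apply: ideal_gen_range_sub; first exact: ideal_gen_ideal.
    by move=> i; rewrite -zl; apply: ideal_gen_range.
  apply: ideal_gen_range_sub; first exact: ideal_gen_ideal.
  by move=> i; rewrite -zr; apply: ideal_gen_range.
have H1 := @ideal_gen_ideal A (range x); have H2 := @ideal_gen_ideal A (range y).
apply: ideal_gen_range_sub; first exact: iadd_ideal.
move=> i; rewrite /z; case: (fintype.split i) => j.
  by apply: iadd_subl => //; apply: ideal_gen_range.
by apply: iadd_subr => //; apply: ideal_gen_range.
Qed.

Lemma fin_gen_princ x : fin_gen (princ x).
Proof.
exists 1%N, (fun=> x); apply/seteqP; split.
  by apply: princ_sub; [exact: ideal_gen_ideal | apply: ideal_gen_sub; exists ord0].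
by apply: ideal_gen_range_sub; [exact: princ_ideal | move=> i; exact: princ_id].
Qed.

Lemma fin_gen_iprod I J : fin_gen I -> fin_gen J -> fin_gen (iprod I J).
Proof.
move=> [m [x ->]] [n [y ->]]; exists #|{: 'I_m * 'I_n}|.
pose z (k : 'I_#|{: 'I_m * 'I_n}|) := x (enum_val k).1 * y (enum_val k).2.
exists z; apply/seteqP; split; last first.
  apply: ideal_gen_range_sub; first exact: iprod_ideal.
  by move=> k; apply: iprod_mem; apply: ideal_gen_range.
apply: iprod_sub; first exact: ideal_gen_ideal.
move=> _ _ /ideal_gen_rangeP[c ->] /ideal_gen_rangeP[d ->].
rewrite mulr_suml; apply: (ideal_sum (ideal_gen_ideal _)) => i _.
rewrite mulr_sumr; apply: (ideal_sum (ideal_gen_ideal _)) => j _.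
have -> : c i * x i * (d j * y j) = c i * d j * z (enum_rank (i, j)).
  by rewrite /z enum_rankK /=; ring.
by apply: (ideal_mull (ideal_gen_ideal _)); exact: ideal_gen_range.
Qed.

Lemma fin_genT : fin_gen [set: A].
Proof.
have [n [x Hx]] := fin_gen_princ 1; exists n, x; rewrite -Hx.
by apply/seteqP; split=> // y _; exists y; rewrite mulr1.
Qed.

Lemma fin_gen_pow I n : fin_gen I -> fin_gen (ideal_pow I n).
Proof.
move=> fI; elim: n => [|n IH]; first by rewrite ideal_pow0; apply: fin_genT.
by rewrite ideal_powS; apply: fin_gen_iprod.
Qed.

Lemma fin_gen_ideal I : fin_gen I -> ideal I.
Proof. by move=> [n [x ->]]; apply: ideal_gen_ideal. Qed.

Lemma exists_forall_ord n (P : 'I_n -> nat -> Prop) :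
  (forall i a b, (a <= b)%N -> P i a -> P i b) ->
  (forall i, exists a, P i a) -> exists a, forall i, P i a.
Proof.
move=> mono /choice[f Pf]; exists (\max_i f i)%N => i.
by apply: (mono _ (f i)) => //; apply: leq_bigmax.
Qed.

Lemma chain_leq (S : nat -> set A) : (forall n, S n `<=` S n.+1) ->
  forall m n, (m <= n)%N -> S m `<=` S n.
Proof.
move=> H m n /subnK <-; elim: (n - m)%N => [//|k IH].
by rewrite addSn; apply: subset_trans IH _; apply: H.
Qed.

Lemma generated_by_leq I d n : (d <= n)%N ->
  generated_by d I -> generated_by n I.
Proof.
move=> dn [x ->]; pose x' (i : 'I_n) := oapp x 0 (insub (i : nat)).
exists x'; apply/seteqP; split; apply: ideal_gen_range_sub; try exact: ideal_gen_ideal.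
  move=> i; have -> : x i = x' (widen_ord dn i).
    by rewrite /x' /= insubT //= => ilt; congr x; apply: val_inj.
  exact: ideal_gen_range.
move=> i; rewrite /x'; case: insubP => [j _ _|_] /=; first exact: ideal_gen_range.
exact: ideal0 (ideal_gen_ideal _).
Qed.

(** Finite generation is asked only above [S 0], because the lemma also serves while a ring is still
    being proved Noetherian. The finitely many generators of the union all occur at some common
    stage. *)
Lemma fin_gen_acc (S : nat -> set A) :
  (forall I, ideal I -> S 0%N `<=` I -> fin_gen I) ->
  (forall n, ideal (S n)) -> (forall n, S n `<=` S n.+1) ->
  exists n, forall k, S k `<=` S n.
Proof.
move=> NA IS mono; have le := chain_leq mono.
have IU : ideal (\bigcup_n S n).
  split.
  - by exists 0%N => //; apply: ideal0.
  - move=> x y [a _ Sx] [b _ Sy]; exists (maxn a b) => //; apply: idealD => //.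
      by apply: le Sx; apply: leq_maxl.
    by apply: le Sy; apply: leq_maxr.
  - by move=> a x [n _ Sx]; exists n => //; apply: ideal_mull.
have [|r [x Ux]] := NA _ IU; first by move=> x Sx; exists 0%N.
have [|i|n Hn] := @exists_forall_ord r (fun i n => S n (x i)).
- by move=> i a b ab; apply: le.
- have [n _ Sn] : (\bigcup_n S n) (x i) by rewrite Ux; apply: ideal_gen_range.
  by exists n.
exists n => k y Sy.
have : (\bigcup_n S n) y by exists k.
by rewrite Ux; apply: ideal_gen_range_sub.
Qed.

Lemma noetherian_max (F : set A -> Prop) I0 : noetherian A ->
  (forall I, F I -> ideal I) -> F I0 ->
  exists M, [/\ F M, I0 `<=` M & forall I, F I -> M `<=` I -> I = M].
Proof.
move=> NA FI F0; apply: contrapT => no.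
have step (I : {I | F I /\ I0 `<=` I}) : exists J : {I | F I /\ I0 `<=` I}, sval I `<` sval J.
  case: I => I [HI sI]; apply: contrapT => noI; apply: no; exists I; split=> // J FJ IJ.
  apply: contrapT => JI; apply: noI.
  exists (exist _ J (conj FJ (subset_trans sI IJ))) => /=.
  by split=> // JI'; apply: JI; apply/seteqP.
have [next Hnext] := choice step.
pose S n := sval (iter n next (exist _ I0 (conj F0 (@subset_refl _ I0)))).
have [|n|n Hn] := @fin_gen_acc S (fun I II _ => NA I II).
- by move=> n; apply: FI; rewrite /S; case: (iter _ _ _) => J [].
- by have [] := Hnext (iter n next (exist _ I0 (conj F0 (@subset_refl _ I0)))).
have [_] := Hnext (iter n next (exist _ I0 (conj F0 (@subset_refl _ I0)))).
by apply; apply: (Hn n.+1).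
Qed.

End IdealTheory.

Arguments ideal_mull {A I a x}.
Arguments ideal_mulr {A I a x}.
Arguments ideal_sum {A I T r p F}.

(** * Noetherian rings: products of primes, prime avoidance, Krull's height theorem, associated
    primes *)

Section NoetherianTheory.
Variable A : comNzRingType.
Implicit Types (I J K M N P Q : set A) (l : seq (set A)).

(* The product of the ideals in [l] is contained in [K]. *)
Fixpoint prod_sub l K : Prop :=
  if l is P :: l' then forall a, P a -> prod_sub l' (colon K a) else K 1.

Lemma colonS K K' a : K `<=` K' -> colon K a `<=` colon K' a.
Proof. by move=> s x; apply: s. Qed.

Lemma prod_subS l K K' : K `<=` K' -> prod_sub l K -> prod_sub l K'.
Proof.
elim: l K K' => [|P l IH] K K' s /=; first exact: s.
by move=> H a /H; apply: IH; apply: colonS.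
Qed.

Lemma prod_sub_cat l1 l2 K1 K : prod_sub l1 K1 ->
  (forall z, K1 z -> prod_sub l2 (colon K z)) -> prod_sub (l1 ++ l2) K.
Proof.
elim: l1 K1 K => [|P l1 IH] K1 K /= H1 H2.
  by apply: prod_subS (H2 _ H1) => x; rewrite /colon /= mulr1.
move=> a Pa; apply: IH (H1 a Pa) _ => z K1z; rewrite colonM; exact: H2.
Qed.

Lemma prod_sub_prime l K Q : prod_sub l K -> prime_ideal Q -> K `<=` Q ->
  exists2 P, P \in l & P `<=` Q.
Proof.
elim: l K => [|P l IH] K /= H PQ KQ; first by case: (prime1 PQ); apply: KQ.
have [PsQ|] := pselect (P `<=` Q); first by exists P => //; rewrite mem_head.
move=> /existsNP[a /not_implyP[Pa Qa]].
have [|P' P'l P'Q] := IH _ (H a Pa) PQ; last by exists P' => //; rewrite in_cons P'l orbT.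
by move=> x /KQ /PQ.2[].
Qed.

Lemma prod_sub_pow n P K : ideal K -> prod_sub (nseq n P) K -> ideal_pow P n `<=` K.
Proof.
elim: n K => [|n IH] K IK /= H.
  by move=> x _; rewrite -(mulr1 x); apply: ideal_mull.
rewrite ideal_powS; apply: iprod_sub => // a b Pa Pb; rewrite mulrC.
by apply: (IH (colon K a)) (H a Pa) _ Pb; apply: colon_ideal.
Qed.

(** Noetherian induction: a maximal counterexample [M] is not prime, so it contains some [x * y] but
    neither factor. The product of [M + (x)] and [M + (y)] lies in [M], so the two lists of primes
    concatenate to one for [M]. *)
Lemma noetherian_prod_sub K : noetherian A -> ideal K ->
  exists2 l, prod_sub l K & forall P, P \in l -> prime_ideal P /\ K `<=` P.
Proof.
move=> NA IK; apply: contrapT => Kno.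
pose F K := ideal K /\ ~ exists2 l, prod_sub l K & forall P, P \in l -> prime_ideal P /\ K `<=` P.
have [M [[IM Mno] _ Mmax]] := @noetherian_max _ F K NA (fun I => @proj1 _ _) (conj IK Kno).
have big J : ideal J -> M `<=` J -> ~ J `<=` M ->
    exists2 l, prod_sub l J & forall P, P \in l -> prime_ideal P /\ M `<=` P.
  move=> IJ MJ JM; apply: contrapT => no; apply: JM.
  rewrite (Mmax J) //; split=> // -[l Hl Pl]; apply: no; exists l => // P /Pl[? ?].
  by split=> //; apply: subset_trans MJ _.
have pM : ~ prime_ideal M.
  move=> PM; apply: Mno; exists [:: M] => [a Ma|P]; first by rewrite /colon /= mul1r.
  by rewrite mem_seq1 => /eqP ->; split.
apply: pM; split.
  by split=> // M1; apply: Mno; exists [::].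
move=> x y Mxy; apply: contrapT => /not_orP[Mx My].
have bigx z : ~ M z -> exists2 l, prod_sub l (iadd M (princ z)) &
    forall P, P \in l -> prime_ideal P /\ M `<=` P.
  move=> Mz; apply: big.
  - by apply: iadd_ideal => //; apply: princ_ideal.
  - by apply: iadd_subl; apply: princ_ideal.
  - by move=> H; apply: Mz; apply: H; apply: iadd_subr => //; apply: princ_id.
have [l1 H1 P1] := bigx _ Mx; have [l2 H2 P2] := bigx _ My.
apply: Mno; exists (l1 ++ l2) => [|P]; last by rewrite mem_cat => /orP[/P1|/P2].
apply: prod_sub_cat H1 _ => _ [a [_ [Ma [c ->] ->]]].
apply: prod_subS H2 => _ [b [_ [Mb [d ->] ->]]]; rewrite /colon /= mulrDr.
apply: idealD => //; first by apply: ideal_mull.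
have -> : (b + d * y) * (c * x) = (c * x) * b + (d * c) * (x * y) by ring.
by apply: idealD => //; apply: ideal_mull.
Qed.

Definition minimal_over K P : Prop :=
  [/\ prime_ideal P, K `<=` P &
      forall Q, prime_ideal Q -> K `<=` Q -> Q `<=` P -> P `<=` Q].

(** Equivalently, a power of [P A_P] lies in [K A_P]. In a list of primes over [K] with product
    inside [K], those contained in [P] contain [P] by minimality, and [n] counts them; each of the
    others gives an element outside [P], and [s] is the product of these. *)
Lemma minimal_over_pow K P : noetherian A -> ideal K -> minimal_over K P ->
  exists s n, ~ P s /\ ideal_pow P n `<=` colon K s.
Proof.
move=> NA IK [PP KP Pmin].
have [l lK Hl] := noetherian_prod_sub NA IK.
suff [s [n [Ps H]]] : exists s n, ~ P s /\
    forall K, prod_sub l K -> prod_sub (nseq n P) (colon K s).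
  exists s, n; split=> //; apply: prod_sub_pow; first exact: colon_ideal.
  exact: H.
elim: l Hl {lK} => [|Q l IH] Hl.
  by exists 1, 0%N; split=> [/(prime1 PP)//|K' /=]; rewrite /colon /= mulr1.
have [|s [n [Ps H]]] := IH.
  by move=> Q' Q'l; apply: Hl; rewrite in_cons Q'l orbT.
have [PQ KQ] : prime_ideal Q /\ K `<=` Q by apply: Hl; rewrite mem_head.
have [QP|] := pselect (Q `<=` P).
  exists s, n.+1; split=> // K' /= HK a Pa; rewrite colonM mulrC -colonM.
  by apply: H; apply: HK; apply: Pmin.
move=> /existsNP[a /not_implyP[Qa Pa]]; exists (s * a), n; split.
  exact: primeNM.
by move=> K' /= HK; rewrite -colonM; apply: H; apply: HK.
Qed.

Lemma prime_inter_notin P l : prime_ideal P ->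
  (forall Q, Q \in l -> ideal Q /\ ~ Q `<=` P) ->
  exists2 z, ~ P z & forall Q, Q \in l -> Q z.
Proof.
move=> PP; elim: l => [|Q l IH] H; first by exists 1 => //; apply: prime1.
have [|z Pz Hz] := IH; first by move=> Q' Q'l; apply: H; rewrite in_cons Q'l orbT.
have [IQ /existsNP[b /not_implyP[Qb Pb]]] : ideal Q /\ ~ Q `<=` P.
  by apply: H; rewrite mem_head.
exists (b * z); first exact: primeNM.
move=> Q'; rewrite in_cons => /orP[/eqP ->|Q'l]; first exact: ideal_mulr.
apply: ideal_mull; last exact: Hz.
by have [] : ideal Q' /\ ~ Q' `<=` P by apply: H; rewrite in_cons Q'l orbT.
Qed.

Lemma prime_avoidance I l : ideal I ->
  (forall P, P \in l -> prime_ideal P /\ ~ I `<=` P) ->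
  exists2 y, I y & forall P, P \in l -> ~ P y.
Proof.
move=> II; have [n] := ubnP (size l); elim: n l => // n IH [|P l] /= szl Hl.
  by exists 0 => //; apply: ideal0.
have [PP /existsNP[a /not_implyP[Ia Pa]]] : prime_ideal P /\ ~ I `<=` P.
  by apply: Hl; rewrite mem_head.
(* Primes inside [P] are dropped, since avoiding [P] avoids them too. If the [y] found for the
   others lies in [P], it is corrected by [z * a], with [z] in all the others but not in [P]. *)
pose l' := [seq Q <- l | `[< ~ Q `<=` P >]].
have l'P Q : Q \in l' -> prime_ideal Q /\ ~ Q `<=` P.
  rewrite mem_filter => /andP[/asboolP QP Ql]; split=> //.
  by have [] : prime_ideal Q /\ ~ I `<=` Q by apply: Hl; rewrite in_cons Ql orbT.
have [|Q Ql'|y Iy Hy] := IH l'.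
- by rewrite ltnS in szl; apply: leq_ltn_trans szl; rewrite size_filter count_size.
- by apply: Hl; move: Ql'; rewrite mem_filter in_cons => /andP[_ ->]; rewrite orbT.
have good u : I u -> ~ P u -> (forall Q, Q \in l' -> ~ Q u) ->
    exists2 y, I y & forall P0, P0 \in P :: l -> ~ P0 y.
  move=> Iu Pu l'u; exists u => // Q; rewrite in_cons => /orP[/eqP -> //|Ql].
  have [/(_ u) QP /QP//|QP] := pselect (Q `<=` P).
  by apply: l'u; rewrite mem_filter Ql andbT; apply/asboolP.
have [Py|Py] := pselect (P y); last exact: good Hy.
have [Q /l'P[/prime_idealW]//|z Pz Hz] := @prime_inter_notin P l' PP.
apply: (good (y + z * a)).
- by apply: idealD => //; apply: ideal_mull.
- move=> Pyz; apply: (primeNM PP Pz Pa).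
  by rewrite -(addKr y (z * a)) addrC; apply: (idealB (prime_idealW PP)).
- move=> Q Ql' Qyz; apply: (Hy Q Ql'); have [PQ _] := l'P _ Ql'.
  rewrite -(addrK (z * a) y); apply: (idealB (prime_idealW PQ)) => //.
  by apply: (ideal_mulr (prime_idealW PQ)); apply: Hz.
Qed.

Fixpoint height_ge n Q : Prop :=
  if n is n'.+1 then prime_ideal Q /\ exists2 Q', Q' `<` Q & height_ge n' Q'
  else prime_ideal Q.

Lemma height_ge_prime n Q : height_ge n Q -> prime_ideal Q.
Proof. by case: n => [|n] // []. Qed.

Lemma height_geS n Q Q' : prime_ideal Q -> Q' `<=` Q -> height_ge n Q' -> height_ge n Q.
Proof.
case: n => [|n] //= PQ sQ [PQ' [Q'' [s1 s2] H]]; split=> //; exists Q'' => //.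
by split; [exact: subset_trans s1 sQ | move=> s; apply: s2; apply: subset_trans s].
Qed.

Lemma minimal_over_params P d : noetherian A -> prime_ideal P ->
  (forall n, height_ge n P -> (n <= d)%N) ->
  exists2 x : 'I_d -> A, forall i, P (x i) & minimal_over (ideal_gen (range x)) P.
Proof.
move=> NA PP Hd.
(* Invariant: a prime properly inside [P] that contains the first [k] parameters has height at least
   [k]. The next parameter [y] avoids the listed primes that do not contain [P], so a prime properly
   inside [P] that contains [y] as well lies properly above one of them. After [d] parameters such a
   prime would give [P] height [d + 1]. *)
have [x Px Hx] : exists2 x : 'I_d -> A, forall i, P (x i) & forall Q, prime_ideal Q ->
    ideal_gen (range x) `<=` Q -> Q `<` P -> height_ge d Q.
  elim: (d) => [|k [x Px Hx]]; first by exists (fun=> 0) => // i; case: PP => -[[]].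
  have [l lK Hl] := noetherian_prod_sub NA (ideal_gen_ideal (range x)).
  pose l' := [seq Q <- l | `[< ~ P `<=` Q >]].
  have [Q|y Py Hy] := @prime_avoidance P l' (prime_idealW PP).
    by rewrite mem_filter => /andP[/asboolP PQ /Hl[]].
  pose x' (i : 'I_k.+1) := oapp x y (unlift ord0 i).
  exists x' => [i|Q PQ xQ QP]; first by rewrite /x'; case: unliftP => [j|] _ /=.
  have x0 : x' ord0 = y by rewrite /x' unlift_none.
  have xS i : x' (lift ord0 i) = x i by rewrite /x' liftK.
  have xQ' : ideal_gen (range x) `<=` Q.
    apply: ideal_gen_range_sub; first exact: prime_idealW.
    by move=> i; rewrite -xS; apply: xQ; apply: ideal_gen_range.
  have [Q' Q'l Q'Q] := prod_sub_prime lK PQ xQ'; have [PQ' xQ''] := Hl _ Q'l.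
  have Q'P : ~ P `<=` Q' by move=> PQ''; apply: QP.2; apply: subset_trans PQ'' _.
  split=> //; exists Q'.
    split=> // QQ'; apply: (Hy Q'); first by rewrite mem_filter Q'l andbT; apply/asboolP.
    by apply: QQ'; rewrite -x0; apply: xQ; apply: ideal_gen_range.
  by apply: Hx => //; split=> //; apply: subset_trans Q'Q QP.1.
exists x => //; split=> //; first by apply: ideal_gen_range_sub => //; apply: prime_idealW.
move=> Q PQ xQ QP; apply: contrapT => PQ'.
by have := Hd d.+1; rewrite ltnn => H; apply/notF/H; split=> //; exists Q => //; apply: Hx.
Qed.

(** Nakayama's lemma by elimination instead of determinants: [u = s0 - c0 ord0] is outside [P], so
    the first relation is solved for [u * x ord0] and substituted into [u] times each of the
    others. *)
Lemma nakayama_local_sum P N n (x : 'I_n -> A) : prime_ideal P -> ideal N ->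
  (forall i, exists s b (c : 'I_n -> A), [/\ ~ P s, N b, forall j, P (c j) &
     s * x i = b + \sum_j c j * x j]) ->
  exists2 s, ~ P s & forall i, N (s * x i).
Proof.
move=> PP IN; have IP := prime_idealW PP; elim: n x => [|n IH] x H.
  by exists 1 => [|[]//]; apply: prime1.
have [s0 [b0 [c0 [Ps0 Nb0 Pc0]]]] := H ord0; rewrite big_ord_recl => E0.
pose u := s0 - c0 ord0.
have Pu : ~ P u.
  by move=> Pu; apply: Ps0; rewrite -(subrK (c0 ord0) s0); apply: idealD.
have {}E0 : u * x ord0 = b0 + \sum_j c0 (lift ord0 j) * x (lift ord0 j).
  by rewrite /u mulrBl E0; ring.
have [|s Ps Ns] := IH (fun i => x (lift ord0 i)).
  move=> i; have [s [b [c [Ps Nb Pc]]]] := H (lift ord0 i); rewrite big_ord_recl => E.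
  exists (u * s), (u * b + c ord0 * b0),
    (fun j => u * c (lift ord0 j) + c ord0 * c0 (lift ord0 j)); split.
  - exact: primeNM.
  - by apply: idealD => //; apply: ideal_mull.
  - by move=> j; apply: idealD => //; [apply: ideal_mull | apply: ideal_mulr].
  - have -> : \sum_j (u * c (lift ord0 j) + c ord0 * c0 (lift ord0 j)) * x (lift ord0 j) =
        u * (\sum_j c (lift ord0 j) * x (lift ord0 j)) + c ord0 * (u * x ord0 - b0).
      rewrite E0 addrAC subrr add0r !mulr_sumr -big_split /=.
      by apply: eq_bigr => j _; ring.
    by rewrite -mulrA E; ring.
exists (s * u) => [|i]; first exact: primeNM.
have [j ->|->] := unliftP ord0 i; first by rewrite mulrAC; apply: ideal_mulr.
rewrite -mulrA E0 mulrDr mulr_sumr; apply: idealD => //; first exact: ideal_mull.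
by apply: (ideal_sum IN) => j _; rewrite mulrCA; apply: ideal_mull.
Qed.

Lemma nakayama_local P N M : prime_ideal P -> ideal N -> fin_gen M ->
  (forall a, M a -> exists2 s, ~ P s & iadd N (iprod P M) (s * a)) ->
  exists2 s, ~ P s & forall a, M a -> N (s * a).
Proof.
move=> PP IN [n [x ->]] H.
have [i|s Ps Ns] := @nakayama_local_sum P N n x PP IN.
  have [s Ps [b [d [Nb]]]] := H _ (ideal_gen_range i).
  move=> /(iprod_genP _ _ (prime_idealW PP))[c Pc ->] E.
  by exists s, b, c.
exists s => // a /ideal_gen_rangeP[c ->]; rewrite mulr_sumr.
by apply: (ideal_sum IN) => i _; rewrite mulrCA; apply: ideal_mull.
Qed.

(* [I A_P] contracted to [A], for a prime [P]. *)
Definition contract P I : set A := [set a | exists2 s, ~ P s & I (s * a)].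

Lemma contract_ideal P I : prime_ideal P -> ideal I -> ideal (contract P I).
Proof.
move=> PP II; split.
- by exists 1; [exact: prime1 | rewrite mulr0; apply: ideal0].
- move=> x y [s Ps Ix] [t Pt Iy]; exists (s * t); first exact: primeNM.
  have -> : s * t * (x + y) = t * (s * x) + s * (t * y) by ring.
  by apply: idealD => //; apply: ideal_mull.
- by move=> a x [s Ps Ix]; exists s => //; rewrite mulrCA; apply: ideal_mull.
Qed.

Lemma contract_sub P I : prime_ideal P -> I `<=` contract P I.
Proof. by move=> PP x Ix; exists 1; [exact: prime1 | rewrite mul1r]. Qed.

Lemma contractS P I J : I `<=` J -> contract P I `<=` contract P J.
Proof. by move=> IJ x [s Ps /IJ]; exists s. Qed.

Lemma contract_idem P I t a : prime_ideal P -> ~ P t ->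
  contract P I (t * a) -> contract P I a.
Proof.
move=> PP Pt [s Ps Ista]; exists (s * t); last by rewrite -mulrA.
exact: primeNM.
Qed.

(* [A_P / K A_P] is Artinian if a power of [P A_P] is contained in [K A_P]. *)
Lemma dcc_local P K s n (S : nat -> set A) : prime_ideal P -> fin_gen P -> ~ P s ->
  ideal_pow P n `<=` colon K s ->
  (forall k, ideal (S k)) -> (forall k, K `<=` S k) -> (forall k, S k.+1 `<=` S k) ->
  (forall k t a, ~ P t -> S k (t * a) -> S k a) ->
  exists k, forall j, (k <= j)%N -> S k `<=` S j.
Proof.
move=> PP fP Ps Pn IS KS mono sat.
have le i j : (i <= j)%N -> S j `<=` S i.
  move=> /subnK <-; elim: (j - i)%N => [//|k IH].
  by rewrite addSn; apply: subset_trans IH; apply: mono.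
(* The traces of the chain on [V] stabilize. This is carried from [P^n], which lies in every [S k]
   since [s] can be cancelled there, down to [P^0], the whole ring. *)
pose stable V := exists k, forall j, (k <= j)%N -> V `&` S k `<=` S j.
(* Locally at [P], the quotient of [U + (b)] by [U] is at most a line over the residue field. Either
   every [S j] has an element whose coefficient at [b] is outside [P], and [c * b] can be
   eliminated, or from some [j0] on the coefficients lie in [P] and the trace falls into [U]. *)
have add U b : ideal U -> (forall p, P p -> U (p * b)) -> stable U ->
    stable (iadd U (princ b)).
  move=> IU PbU [k Hk].
  have [all|] := pselect (forall j, exists u c, [/\ U u, ~ P c & S j (u + c * b)]).
    exists k => j kj _ [[u [_ [Uu [c ->] ->]]] Sk].
    have [u' [c' [Uu' Pc' Sj]]] := all j; apply: (sat j c') => //.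
    have E : c' * (u + c * b) - c * (u' + c' * b) = c' * u - c * u' by ring.
    rewrite -(subrK (c * (u' + c' * b)) (c' * _)); apply: (idealD (IS j)); last first.
      exact: (ideal_mull (IS j)).
    apply: (Hk j kj); split.
      by rewrite E; apply: (idealB IU); apply: (ideal_mull IU).
    apply: (idealB (IS k)); first exact: (ideal_mull (IS k)).
    by apply: (ideal_mull (IS k)); apply: (le k j).
  move=> /existsNP[j0 no]; exists (maxn k j0) => j; rewrite geq_max => /andP[kj j0j].
  move=> _ [[u [_ [Uu [c ->] ->]]] Smax].
  have Pc : P c.
    apply: contrapT => Pc; apply: no; exists u, c; split=> //.
    by apply: le Smax; apply: leq_maxr.
  apply: (Hk j kj); split; first by apply: (idealD IU) => //; apply: PbU.
  by apply: le Smax; apply: leq_maxl.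
suff [k Hk] : stable setT by exists k => j kj x Sx; apply: (Hk j kj).
rewrite -(ideal_pow0 P).
have : stable (ideal_pow P n).
  exists 0%N => j _ y [/Pn Ky _]; apply: (sat j s) => //; apply: KS.
  by rewrite mulrC.
elim: n {Pn} => // n IH stn; apply: IH.
have [r [x Ex]] := fin_gen_pow n fP.
have PxP i p : P p -> ideal_pow P n.+1 (p * x i).
  by move=> Pp; rewrite ideal_powS; apply: iprod_mem => //; rewrite Ex; apply: ideal_gen_range.
pose V (l : seq 'I_r) := foldr (fun i U => iadd U (princ (x i))) (ideal_pow P n.+1) l.
have VI (l : seq 'I_r) : ideal (V l).
  elim: l => [|i l IHl] /=; first exact: ideal_pow_ideal.
  by apply: iadd_ideal => //; apply: princ_ideal.
have V0 (l : seq 'I_r) : ideal_pow P n.+1 `<=` V l.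
  elim: l => [|i l IHl] //=; apply: subset_trans IHl _.
  by apply: iadd_subl; apply: princ_ideal.
have Vx (l : seq 'I_r) i : i \in l -> V l (x i).
  elim: l => [|i' l IHl] //=; rewrite in_cons => /orP[/eqP ->|/IHl].
    by apply: iadd_subr; [exact: VI | exact: princ_id].
  by apply: iadd_subl; apply: princ_ideal.
have stV (l : seq 'I_r) : stable (V l).
  by elim: l => [|i l IHl] //=; apply: add => // p Pp; apply: V0; apply: PxP.
have [k Hk] := stV (enum 'I_r); exists k => j kj y [Py Sy]; apply: (Hk j kj).
split=> //; move: y Py {Sy}; rewrite Ex; apply: ideal_gen_range_sub => //.
by move=> i; apply: Vx; rewrite mem_enum.
Qed.

(** Krull's principal ideal theorem in the domain [A / J]. Locally at [P] the quotient by [J + (x)]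
    is Artinian, so the symbolic powers of [Q] stabilize once [x] is added; Nakayama at [P] removes
    [x], and Nakayama at [Q] forces a power of [Q] into [J]. *)
Lemma krull_principal J Q P x : noetherian A ->
  prime_ideal J -> prime_ideal Q -> J `<=` Q -> Q `<` P ->
  minimal_over (iadd J (princ x)) P -> Q `<=` J.
Proof.
move=> NA PJ PQ JQ [QP PQ'] minP; have [PP KP Pmin] := minP.
have IJ := prime_idealW PJ; have IQ := prime_idealW PQ; have IP := prime_idealW PP.
have Qx : ~ Q x.
  move=> Qx; apply: PQ'; apply: Pmin => //; apply: iadd_sub => //.
  exact: princ_sub.
have IK : ideal (iadd J (princ x)) by apply: iadd_ideal => //; apply: princ_ideal.
have [s [n [Ps Pn]]] := minimal_over_pow NA IK minP.
(* [T k] is the [k]-th symbolic power of [Q], taken modulo [J]. *)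
pose B k := iadd (ideal_pow Q k) J.
pose T k := contract Q (B k).
have IB k : ideal (B k) by apply: iadd_ideal => //; apply: ideal_pow_ideal.
have IT k : ideal (T k) by apply: contract_ideal.
have JB k : J `<=` B k by apply: iadd_subr; apply: ideal_pow_ideal.
have JT k : J `<=` T k by apply: subset_trans (JB k) _; apply: contract_sub.
have BS k : B k.+1 `<=` B k.
  apply: iadd_sub => //; apply: subset_trans; first exact: ideal_powS_sub.
  exact: iadd_subl.
pose S k := contract P (iadd (T k) (princ x)).
have ITx k : ideal (iadd (T k) (princ x)) by apply: iadd_ideal => //; apply: princ_ideal.
have TTx k : T k `<=` iadd (T k) (princ x) by apply: iadd_subl; apply: princ_ideal.
have [k|k|k|k t a Pt|k Hk] := @dcc_local P _ s n S PP (NA _ IP) Ps Pn.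
- by apply: contract_ideal.
- apply: (subset_trans _ (@contract_sub P _ PP)); apply: iadd_sub => //.
    exact: subset_trans (JT k) (TTx k).
  exact: iadd_subr.
- apply: contractS; apply: iadd_sub => //.
    by apply: subset_trans (TTx k); apply: contractS.
  exact: iadd_subr.
- exact: contract_idem.
(* Write [t * a = b + c * x] with [b] in [T k.+1]. Then [c * x] is in [T k], and so is [c] because
   [x] is outside [Q]; locally at [P], this puts [T k] inside [T k.+1 + x T k]. *)
have TS : T k `<=` T k.+1.
  have [|t Pt Ht] := @nakayama_local P (T k.+1) (T k) PP (IT _) (NA _ (IT k)).
    move=> a Ta.
    have [t Pt] : S k.+1 a.
      by apply: Hk (leqnSn k) _ _; apply: contract_sub => //; apply: TTx.
    move=> [b [_ [Tb [c ->] E]]]; exists t => //; exists b, (c * x); split=> //.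
    rewrite mulrC; apply: iprod_mem.
      by apply: KP; apply: iadd_subr => //; apply: princ_id.
    apply: (@contract_idem Q _ x) => //; rewrite -/(T k).
    rewrite (_ : x * c = t * a - b); last by rewrite E; ring.
    by apply: (idealB (IT k)); [exact: (ideal_mull (IT k)) | apply: contractS Tb].
  by move=> a /Ht; apply: contract_idem => // /QP.
apply: (@prime_pow _ J Q k PJ).
(* Locally at [Q], the power [Q^k] now lies in [J + Q Q^k], so some [t] outside [Q] multiplies it
   into the prime [J], which does not contain [t]. *)
have [|t Qt Ht] := @nakayama_local Q J (ideal_pow Q k) PQ IJ (NA _ (ideal_pow_ideal _ _)).
  move=> a Qa; have [|t Qt] := TS a.
    by apply: contract_sub => //; apply: iadd_subl.
  move=> [b [c [Qb Jc E]]]; exists t => //; exists c, b; rewrite -ideal_powS.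
  by split=> //; rewrite addrC.
by move=> a /Ht /PJ.2[/JQ|].
Qed.

(** Induction on the number of generators. For [Q] maximal among the primes properly inside [P], and
    [x i] outside [Q], the prime [P] is minimal over [Q + (x i)]. Locally at [P], powers of the
    other generators are then congruent modulo [x i] to elements [q j] of [Q], and by
    [krull_principal] [Q] is minimal over these, one fewer in number. *)
Lemma krull_height n e P (x : 'I_e -> A) : noetherian A ->
  minimal_over (ideal_gen (range x)) P -> height_ge n P -> (n <= e)%N.
Proof.
move=> NA; elim: e n P x => [|e IH] [|n] P x //= minP [PP [Q0 Q0P HQ0]];
    have [_ xP Pmin] := minP; have IP := prime_idealW PP.
  case: Q0P => s0 []; apply: Pmin => //; first exact: height_ge_prime HQ0.
  by apply: ideal_gen_range_sub; [exact: prime_idealW (height_ge_prime HQ0) | case].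
have PQ0 := height_ge_prime HQ0.
have [||Q [[PQ QP] Q0Q Qmax]] := @noetherian_max _ (fun I => prime_ideal I /\ I `<` P) Q0 NA.
- by move=> I [/prime_idealW].
- by [].
have IQ := prime_idealW PQ.
have HQ : height_ge n Q by apply: height_geS HQ0.
have [i Qi] : exists i, ~ Q (x i).
  apply: contrapT => /forallNP no; apply: QP.2; apply: Pmin => //; last exact: QP.1.
  by apply: ideal_gen_range_sub => // i; apply: contrapT; apply: no.
have IK : ideal (iadd Q (princ (x i))) by apply: iadd_ideal => //; apply: princ_ideal.
have Px j : P (x j) by apply: xP; apply: ideal_gen_range.
have minK : minimal_over (iadd Q (princ (x i))) P.
  split=> //; first by apply: iadd_sub => //; [exact: QP.1 | exact: princ_sub].
  move=> Q' PQ' KQ' Q'P; apply: contrapT => PQ''; apply: Qi.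
  rewrite -(Qmax Q') //; last by apply: subset_trans KQ'; apply: iadd_subl; apply: princ_ideal.
  by apply: KQ'; apply: iadd_subr => //; apply: princ_id.
have [s [N [Ps PN]]] := minimal_over_pow NA IK minK.
have /choice[q Hq] j : exists q, Q q /\ exists r, x (lift i j) ^+ N * s = q + r * x i.
  have [q [_ [Qq [r ->] E]]] := PN _ (@ideal_pow_exp _ P _ N (Px (lift i j))).
  by exists q; split=> //; exists r.
apply: (IH n Q q) => //; split=> //.
  by apply: ideal_gen_range_sub => // j; have [] := Hq j.
move=> J PJ qJ JQ; apply: (krull_principal (x := x i) NA PJ PQ JQ QP).
split=> //.
  by apply: iadd_sub => //; [apply: subset_trans JQ QP.1 | exact: princ_sub].
move=> Q' PQ' KQ' Q'P; apply: Pmin => //; have IQ' := prime_idealW PQ'.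
have Q'i : Q' (x i).
  by apply: KQ'; apply: iadd_subr; [exact: prime_idealW | exact: princ_id].
apply: ideal_gen_range_sub => // j; have [k ->|-> //] := unliftP i j.
have [_ [r E]] := Hq k; apply: (prime_exp PQ' (n := N)).
have /PQ'.2[//|/Q'P//] : Q' (x (lift i k) ^+ N * s).
rewrite E; apply: (idealD IQ'); last exact: (ideal_mull IQ').
by apply: KQ'; apply: iadd_subl; [exact: princ_ideal | apply: qJ; apply: ideal_gen_range].
Qed.

(* With [S] the complement of a prime, this finds associated primes inside it. *)
Lemma colon_prime (S : set A) K a0 : noetherian A -> ideal K -> S 1 ->
  (forall s t, S s -> S t -> S (s * t)) -> (forall s, S s -> ~ K (s * a0)) ->
  exists a, [/\ colon K a0 `<=` colon K a, prime_ideal (colon K a) &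
    forall s, S s -> ~ K (s * a)].
Proof.
move=> NA IK S1 SM Sa0.
pose F I := exists2 a, I = colon K a & forall s, S s -> ~ K (s * a).
have [I [a -> _]||_ [[a -> Sa] sa max]] := @noetherian_max _ F (colon K a0) NA.
- exact: colon_ideal.
- by exists a0.
exists a; split=> //; split.
  by split; [exact: colon_ideal | exact: Sa].
(* In the first case [(K : s a) = (K : a)] by maximality, and it contains [y]. In the second [y * a]
   is again admissible, and [(K : y a) = (K : a)] contains [x]. *)
move=> x y Kxy; have [[s [Ss Ksy]]|no] := pselect (exists s, S s /\ K (s * (y * a))).
  right; have <- : colon K (s * a) = colon K a.
    apply: max.
      by exists (s * a) => // t St; rewrite mulrA; apply: Sa; apply: SM.
    by move=> z Kz; rewrite /colon /= mulrCA; apply: ideal_mull.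
  by rewrite /colon /= mulrCA.
left; have <- : colon K (y * a) = colon K a.
  apply: max; last by move=> z Kz; rewrite /colon /= mulrCA; apply: ideal_mull.
  by exists (y * a) => // s Ss Ks; apply: no; exists s.
by rewrite /colon /= mulrA.
Qed.

(** For the complement of [P] and the element 1, [colon_prime] gives a prime [(K : a)] inside [P],
    and minimality makes it [P]. *)
Lemma minimal_over_colon K P : noetherian A -> ideal K -> minimal_over K P ->
  exists a, P = colon K a.
Proof.
move=> NA IK [PP KP Pmin].
have [|s t Ps Pt|s Ps|a [_ Pa Ha]] := @colon_prime (~` P) K 1 NA IK.
- exact: prime1.
- exact: primeNM.
- by rewrite mulr1 => /KP.
have aP : colon K a `<=` P by move=> x Kx; apply: contrapT => Px; exact: (Ha x).
exists a; apply/seteqP; split=> //; apply: Pmin => //.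
exact: colon_sub.
Qed.

End NoetherianTheory.

(** * Noetherianity from closedness of the finitely generated ideals *)

Section CompleteNoetherian.
Variables (A : comNzRingType) (m : set A).
Hypothesis m_maximal : maximal_ideal m.
Hypothesis m_fin_gen : fin_gen m.
Hypothesis fin_gen_closed : forall I : set A, fin_gen I ->
  forall y, (forall k, iadd I (ideal_pow m k) y) -> I y.
Implicit Types (I J : set A).

(** As for power series in [x]: the ideals of leading coefficients contain [J + (x)] and increase,
    so they stabilize. Lifts of their generators up to the stable degree, together with [J], give
    all of [I] modulo every power of [x], and closedness turns this into equality. *)
Lemma fin_gen_above_step J x : fin_gen J -> m x ->
  (forall I, ideal I -> iadd J (princ x) `<=` I -> fin_gen I) ->
  forall I, ideal I -> J `<=` I -> fin_gen I.
Proof.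
move=> fJ mx Hx I II JI.
(* the leading coefficients of the elements of [I] that are divisible by [x^k] *)
pose L k := [set a | exists b, I (a * x ^+ k + b * x ^+ k.+1)].
have IL k : ideal (L k).
  split.
  - by exists 0; rewrite !mul0r addr0; apply: ideal0.
  - move=> a a' [b H] [b' H']; exists (b + b').
    by rewrite !mulrDl addrACA; apply: idealD.
  - move=> c a [b H]; exists (c * b).
    by rewrite -!mulrA -mulrDr; apply: ideal_mull.
have LS k : L k `<=` L k.+1.
  move=> a [b H]; exists b; rewrite !(exprSr x k.+1) !(exprSr x k) in H *.
  rewrite (_ : _ + _ = x * (a * x ^+ k + b * (x ^+ k * x))); first exact: ideal_mull.
  by ring.
have L0 k : iadd J (princ x) `<=` L k.
  apply: iadd_sub => // [j Jj|].
    by exists 0; rewrite mul0r addr0; apply: ideal_mulr => //; apply: JI.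
  (* The element [x] is a leading coefficient in every degree, of [x * x^k - x^(k+1) = 0]. *)
  by apply: princ_sub => //; exists (-1); rewrite exprS mulN1r subrr; apply: ideal0.
have [|K HK] := @fin_gen_acc A L _ IL LS.
  by move=> I' II' sI'; apply: Hx => //; apply: subset_trans sI'; apply: L0.
have /choice[G HG] k : exists G, [/\ fin_gen G, G `<=` I & forall a, L k a ->
    exists z b, G z /\ a * x ^+ k = z + b * x ^+ k.+1].
  have [r [a La]] := Hx _ (IL k) (L0 k).
  have /choice[b Hb] i : L k (a i) by rewrite La; apply: ideal_gen_range.
  exists (ideal_gen (range (fun i => a i * x ^+ k + b i * x ^+ k.+1))); split.
  - exact: fin_gen_gen.
  - exact: ideal_gen_range_sub.
  - move=> a'; rewrite La => /ideal_gen_rangeP[c ->].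
    exists (\sum_i c i * (a i * x ^+ k + b i * x ^+ k.+1)), (- \sum_i c i * b i); split.
      by apply/ideal_gen_rangeP; exists c.
    rewrite mulNr !mulr_suml -sumrB; apply: eq_bigr => i _; ring.
have [Gs [fGs GsI GsG]] : exists Gs, [/\ fin_gen Gs, Gs `<=` I &
    forall k, (k <= K)%N -> G k `<=` Gs].
  elim: (K) => [|k [Gs [fGs GsI GsG]]].
    by exists (G 0%N); have [? ? _] := HG 0%N; split=> // k; rewrite leqn0 => /eqP ->.
  have [fG GI _] := HG k.+1.
  exists (iadd Gs (G k.+1)); split.
  - exact: fin_gen_iadd.
  - exact: iadd_sub.
  - have IGs := fin_gen_ideal fGs; have IG := fin_gen_ideal fG.
    move=> j; rewrite leq_eqVlt => /orP[/eqP ->|]; first exact: iadd_subr.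
    by rewrite ltnS => /GsG s; apply: subset_trans s _; apply: iadd_subl.
have {}HG k a : L k a -> exists z b, Gs z /\ a * x ^+ k = z + b * x ^+ k.+1.
  move=> La; have [kK|/ltnW Kk] := leqP k K.
    by have [_ _ /(_ _ La)[z [b [/(GsG _ kK) ? ->]]]] := HG k; exists z, b.
  have [_ _ /(_ _ (HK _ _ La))[z [b [/(GsG _ (leqnn K)) Gz E]]]] := HG K.
  exists (x ^+ (k - K) * z), b; split.
    by apply: ideal_mull => //; apply: fin_gen_ideal.
  have -> : x ^+ k = x ^+ (k - K) * x ^+ K by rewrite -exprD subnK.
  have -> : x ^+ k.+1 = x ^+ (k - K) * x ^+ K.+1 by rewrite -exprD addnS subnK.
  by rewrite mulrCA E; ring.
have fGt := fin_gen_iadd fGs fJ.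
have IGs := fin_gen_ideal fGs; have IJ := fin_gen_ideal fJ; have IGt := fin_gen_ideal fGt.
have GtI : iadd Gs J `<=` I by apply: iadd_sub.
rewrite (_ : I = iadd Gs J) //; apply/seteqP; split=> // y Iy.
apply: fin_gen_closed => // k.
(* Successive approximation: the remainder [a * x^k] lies in [I], so [a] is in [L k] and the next
   lift pushes the remainder into degree [k + 1]. *)
suff [z [a [Gz ->]]] : exists z a, iadd Gs J z /\ y = z + a * x ^+ k.
  exists z, (a * x ^+ k); split=> //; apply: (ideal_mull (ideal_pow_ideal _ _)).
  exact: ideal_pow_exp.
elim: k => [|k [z [a [Gz E]]]].
  by exists 0, y; rewrite expr0 mulr1 add0r; split=> //; apply: ideal0.
have [|z' [b [Gz' E']]] := HG k a.
  exists 0; rewrite mul0r addr0 (_ : _ * _ = y - z); last by rewrite E; ring.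
  by apply: idealB => //; apply: GtI.
exists (z + z'), b; split; last by rewrite E E'; ring.
by apply: idealD => //; apply: iadd_subl.
Qed.

(** Above the ideal of all generators of [m] there are only [m] and the unit ideal;
    [fin_gen_above_step] then drops one generator at a time until the zero ideal is reached. *)
Lemma complete_noetherian : noetherian A.
Proof.
have [n [x mE]] := m_fin_gen; have [[Im m1] mmax] := m_maximal.
have mx i : m (x i) by rewrite mE; apply: ideal_gen_range.
pose V (l : seq 'I_n) := foldr (fun i U => iadd U (princ (x i))) [set 0] l.
have fV l : fin_gen (V l).
  elim: l => [|i l IH] /=; last by apply: fin_gen_iadd => //; apply: fin_gen_princ.
  rewrite (_ : [set 0] = princ 0); first exact: fin_gen_princ.
  apply/seteqP; split=> [_ ->|_ [c ->]]; last by rewrite mulr0.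
  exact: princ_id.
have Vx l i : i \in l -> V l (x i).
  elim: l => [|i' l IHl] //=; rewrite in_cons => /orP[/eqP ->|/IHl].
    by apply: iadd_subr; [exact: fin_gen_ideal | exact: princ_id].
  by apply: iadd_subl; apply: princ_ideal.
have: forall I, ideal I -> V (enum 'I_n) `<=` I -> fin_gen I.
  move=> I II VI; have mI : m `<=` I.
    rewrite mE; apply: ideal_gen_range_sub => // i; apply: VI; apply: Vx.
    by rewrite mem_enum.
  have [I1|I1] := pselect (I 1); last by rewrite (mmax I).
  rewrite (_ : I = setT); first exact: fin_genT.
  by apply/seteqP; split=> // y _; rewrite -(mulr1 y); apply: ideal_mull.
elim: (enum 'I_n) => [|i l IH] H; last by apply: IH; apply: (fin_gen_above_step _ (mx i)).
by move=> I II; apply: H => // _ ->; apply: ideal0.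
Qed.

End CompleteNoetherian.

(** * Minima and suprema in the extended natural numbers *)

Section ExtendedNat.
Implicit Types (S : set nat).

Lemma enat_min_eq S d : S d -> (forall k, S k -> (d <= k)%N) -> enat_min S = Some d.
Proof.
move=> Sd min; rewrite /enat_min; case: pselect => [ex|[]]; last by exists d; apply/asboolP.
case: ex_minnP => k /asboolP Sk kmin; congr Some; apply/eqP.
by rewrite eqn_leq min // andbT kmin //; apply/asboolP.
Qed.

Lemma enat_min_some S d : enat_min S = Some d -> S d /\ forall k, S k -> (d <= k)%N.
Proof.
rewrite /enat_min; case: pselect => // ex.
case: ex_minnP => k /asboolP Sk kmin [<-]; split=> // j Sj.
by apply: kmin; apply/asboolP.
Qed.

Lemma enat_min_le S d : S d -> enat_le (enat_min S) (Some d).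
Proof.
move=> Sd; rewrite /enat_min; case: pselect => [ex|[]]; last by exists d; apply/asboolP.
by case: ex_minnP => k _ kmin; apply: kmin; apply/asboolP.
Qed.

Lemma enat_sup_eq S d : S d -> (forall k, S k -> (k <= d)%N) -> enat_sup S = Some d.
Proof. by move=> Sd max; apply: enat_min_eq => // k; apply. Qed.

(** The condition [S 0] excludes the empty set, whose supremum 0 is not attained. *)
Lemma enat_sup_some S d : S 0%N -> enat_sup S = Some d ->
  S d /\ forall k, S k -> (k <= d)%N.
Proof.
move=> S0 /enat_min_some[/= ub lub]; split=> //; apply: contrapT => Sd.
case: d => [|d] in ub lub Sd *; first by [].
have := lub d; rewrite /= ltnn => H; apply/notF/H => k Sk.
have := ub k Sk; rewrite leq_eqVlt => /orP[/eqP E|//]; by rewrite E in Sk.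
Qed.

Lemma enat_sup_le S d : (forall k, S k -> (k <= d)%N) -> enat_le (enat_sup S) (Some d).
Proof. exact: enat_min_le. Qed.

End ExtendedNat.

(** * Local rings: Nakayama's lemma, Krull dimension, parameters *)

Section LocalRings.
Variable R : localRing.
Local Notation m := (maxid R).
Implicit Types (I J K N : set R).

Lemma maxid_prime : prime_ideal m.
Proof.
split=> [|x y mxy]; first exact: (maxid_maximal R).1.
apply: contrapT => /not_orP[/local_inv[u ux] my]; apply: my.
by rewrite -(mul1r y) -ux -mulrA; apply: (ideal_mull (maxid_maximal R).1.1).
Qed.

Lemma maxid_ideal : ideal m. Proof. exact: prime_idealW maxid_prime. Qed.

Definition infinitesimal : set R := \bigcap_k ideal_pow m k.

Lemma infinitesimal_maxid : infinitesimal `<=` m.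
Proof. by move=> x /(_ 1%N I); rewrite ideal_pow1 //; apply: maxid_ideal. Qed.

Lemma pideal_sub_maxid I : pideal I -> I `<=` m.
Proof.
move=> [II I1] z Iz; apply: contrapT => /local_inv[y yz].
by apply: I1; rewrite -yz; apply: ideal_mull.
Qed.

Lemma prime_sub_maxid I : prime_ideal I -> I `<=` m.
Proof. by move=> [pI _]; apply: pideal_sub_maxid. Qed.

Lemma local_unitM I s a : ideal I -> ~ m s -> I (s * a) -> I a.
Proof.
by move=> II /local_inv[u us] Isa; rewrite -(mul1r a) -us -mulrA; apply: ideal_mull.
Qed.

Lemma nakayama M N : fin_gen M -> ideal N -> M `<=` iadd N (iprod m M) -> M `<=` N.
Proof.
move=> fM IN sM; have [a Ma|s ms H] := @nakayama_local R m N M maxid_prime IN fM.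
  by exists 1; [exact: prime1 maxid_prime | rewrite mul1r; apply: sM].
by move=> a /H; apply: local_unitM.
Qed.

Lemma minimal_over_maxid I n : ideal I -> I `<=` m -> ideal_pow m n `<=` I ->
  minimal_over I m.
Proof.
move=> II Im mI; split=> //; first exact: maxid_prime.
by move=> Q PQ IQ _; apply: (@prime_pow _ _ _ n PQ); apply: subset_trans IQ.
Qed.

Lemma minimal_over_maxid_pow I : noetherian R -> ideal I -> minimal_over I m ->
  exists n, ideal_pow m n `<=` I.
Proof.
move=> NR II /(minimal_over_pow NR II)[s [n [ms H]]]; exists n => x /H.
by rewrite /colon /= mulrC; apply: local_unitM.
Qed.

Lemma prime_chain_height (C : set R -> Prop) n : prime_chain C n -> height_ge n m.
Proof.
move=> [p [Hp Hlt]].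
have H i : (i <= n)%N -> height_ge i (p i).
  elim: i => [|i IH] ilt /=; have [Pi _] := Hp _ ilt => //.
  by split=> //; exists (p i); [exact: Hlt | apply: IH; exact: ltnW].
apply: height_geS (H n (leqnn n)); first exact: maxid_prime.
by apply: prime_sub_maxid; have [] := Hp n (leqnn n).
Qed.

Lemma height_chain n Q : height_ge n Q -> exists p : nat -> set R,
  [/\ forall i, (i <= n)%N -> prime_ideal (p i), forall i, (i < n)%N -> p i `<` p i.+1 &
      p n = Q].
Proof.
elim: n Q => [|n IH] Q /=; first by exists (fun=> Q).
move=> [PQ [Q' Q'Q /IH[p [Hp Hlt pn]]]].
exists (fun i => if (i <= n)%N then p i else Q); split.
- by move=> i _; case: ifP => // /Hp.
- move=> i; rewrite ltnS => ilt; rewrite ilt; case: ltnP => [/Hlt //|nlt].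
  by have -> : i = n; [apply/eqP; rewrite eqn_leq ilt | rewrite pn].
- by rewrite ltnn.
Qed.

Lemma prime_chain_krull n : prime_chain (fun _ : set R => True) n <-> height_ge n m.
Proof.
split=> [|/height_chain[p [Hp Hlt _]]]; first exact: prime_chain_height.
by exists p; split=> // i /Hp.
Qed.

Lemma krull_dimP d : krull_dim R = Some d <->
  height_ge d m /\ forall n, height_ge n m -> (n <= d)%N.
Proof.
split=> [H|[Hd Hmax]].
  have [|H1 H2] := enat_sup_some _ H; first exact/(prime_chain_krull 0)/maxid_prime.
  by split=> [|n /prime_chain_krull]; [exact/prime_chain_krull | exact: H2].
- apply: enat_sup_eq; first exact/prime_chain_krull.
  by move=> k /prime_chain_krull; apply: Hmax.
Qed.

Lemma krull_dim_le n : (forall k, height_ge k m -> (k <= n)%N) ->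
  exists2 d, krull_dim R = Some d & (d <= n)%N.
Proof.
move=> H; have : enat_le (krull_dim R) (Some n).
  by apply: enat_sup_le => k /prime_chain_krull; apply: H.
by case: (krull_dim R) => // d dn; exists d.
Qed.

Lemma krull_dim_params e (x : 'I_e -> R) n : noetherian R -> (forall i, m (x i)) ->
  ideal_pow m n `<=` ideal_gen (range x) -> exists2 d, krull_dim R = Some d & (d <= e)%N.
Proof.
move=> NR mx mX; apply: krull_dim_le => k; apply: (krull_height (x := x)) => //.
apply: (@minimal_over_maxid _ n) => //; first exact: ideal_gen_ideal.
by apply: ideal_gen_range_sub => //; apply: maxid_ideal.
Qed.

Lemma params_exist d : noetherian R -> krull_dim R = Some d ->
  exists2 x : 'I_d -> R, forall i, m (x i) & minimal_over (ideal_gen (range x)) m.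
Proof.
by move=> NR /krull_dimP[_ H]; apply: minimal_over_params => //; exact: maxid_prime.
Qed.

End LocalRings.

Arguments infinitesimal : clear implicits.

(** * The Koszul complex with coefficients modulo an ideal *)

Section KoszulComplex.
Variables (A : comNzRingType) (n : nat) (x : 'I_n -> A).
Implicit Types (b c : {ffun {set 'I_n} -> A}) (S : {set 'I_n}).

Definition koszul_sign S (j : 'I_n) : A := (-1) ^+ #|[set k in S | (k < j)%N]|%SET.

Lemma koszul_dE c S :
  koszul_d x c S = \sum_(j | j \notin S) koszul_sign S j * x j * c (j |: S)%SET.
Proof. by rewrite ffunE. Qed.

Lemma koszul_signU S (j l : 'I_n) : j \notin S -> (j < l)%N ->
  koszul_sign (j |: S)%SET l = - koszul_sign S l.
Proof.
move=> jS jl; rewrite /koszul_sign.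
rewrite (_ : [set k in _ | _]%SET = (j |: [set k in S | (k < l)%N])%SET).
  by rewrite cardsU1 inE (negPf jS) /= add1n exprS mulN1r.
by apply/setP => k; rewrite !inE; case: eqP => // ->; rewrite jl.
Qed.

Lemma koszul_signU_ge S (j l : 'I_n) : (l <= j)%N ->
  koszul_sign (j |: S)%SET l = koszul_sign S l.
Proof.
move=> lj; rewrite /koszul_sign; congr (_ ^+ #|pred_of_set _|).
apply/setP => k; rewrite !inE; case: eqP => // ->.
by rewrite ltnNge lj /= !andbF.
Qed.

Lemma koszul_dd c : koszul_d x (koszul_d x c) = 0.
Proof.
apply/ffunP => S; rewrite koszul_dE [RHS]ffunE.
pose f (j l : 'I_n) := koszul_sign S j * x j *
  (koszul_sign (j |: S)%SET l * x l * c (l |: (j |: S))%SET).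
have f_anti j l : j \notin S -> l \notin S -> (j < l)%N -> f l j = - f j l.
  move=> jS lS jl; rewrite /f (koszul_signU jS jl) (koszul_signU_ge _ (ltnW jl)).
  by rewrite finset.setUCA; ring.
transitivity (\sum_(j | j \notin S) \sum_(l | (l \notin S) && (l != j)) f j l).
  apply: eq_bigr => j jS; rewrite koszul_dE mulr_sumr; apply: eq_bigl => l.
  by rewrite !inE negb_or andbC.
(* By antisymmetry [f j l] is [g j l - g l j] off the diagonal, and the double sum of this cancels
   when the two summations are exchanged. *)
pose g (j l : 'I_n) := if (j < l)%N then f j l else 0.
transitivity (\sum_(j | j \notin S) \sum_(l | l \notin S) (g j l - g l j)).
  apply: eq_bigr => j jS; rewrite big_mkcondr /=; apply: eq_bigr => l lS.
  rewrite /g; case: (ltngtP j l) => [jl|lj|/val_inj ->]; last by rewrite eqxx subrr.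
    by rewrite ifT ?subr0 //; apply: contraTneq jl => ->; rewrite ltnn.
  rewrite ifT ?sub0r; first by rewrite (f_anti l j).
  by apply: contraTneq lj => ->; rewrite ltnn.
under eq_bigr do rewrite sumrB.
rewrite sumrB [X in _ - X]exchange_big /=; exact: subrr.
Qed.

Lemma koszul_degree_d i b : koszul_degree i.+1 b -> koszul_degree i (koszul_d x b).
Proof.
move=> db S; rewrite koszul_dE => H.
have [j /andP[jS bj]] : exists j, (j \notin S) && (b (j |: S)%SET != 0).
  apply/existsP; apply: contraNT H => /existsPn no; apply/eqP.
  apply: big1 => j jS; have := no j; rewrite jS /= negbK => /eqP ->.
  by rewrite mulr0.
by have := db _ bj; rewrite cardsU1 jS add1n => -[].
Qed.

Lemma koszul_d_comb (y : A) b c S :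
  koszul_d x [ffun T => b T - y * c T] S = koszul_d x b S - y * koszul_d x c S.
Proof.
rewrite !koszul_dE mulr_sumr -sumrB.
by apply: eq_bigr => j _; rewrite ffunE; ring.
Qed.

Lemma koszul_d_ideal (J : set A) c : ideal J -> (forall S, J (c S)) ->
  forall S, J (koszul_d x c S).
Proof.
by move=> IJ Jc S; rewrite koszul_dE; apply: (ideal_sum IJ) => j _; apply: ideal_mull.
Qed.

Lemma koszul_homology_degree i :
  koszul_homology_neq0 x i -> (i <= n)%N.
Proof.
move=> [c [[dc _] cb]]; have [[S /dc <-]|no] := pselect (exists S, c S != 0).
  by have := max_card (mem S); rewrite card_ord.
have c0 : c = 0.
  by apply/ffunP => S; rewrite [RHS]ffunE; apply: contrapT => /eqP cS; apply: no; exists S.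
case: cb; exists 0 => [S|]; first by rewrite ffunE eqxx.
apply/ffunP => S; rewrite c0 koszul_dE [LHS]ffunE big1 // => j _.
by rewrite ffunE mulr0.
Qed.

(* Nonvanishing of the Koszul homology of [x] on [A / J], expressed with
   elements of [A]. *)
Definition koszul_mod_neq0 (J : set A) i : Prop :=
  exists c, [/\ koszul_degree i c, forall S, J (koszul_d x c S) &
    forall b, koszul_degree i.+1 b -> ~ forall S, J (c S - koszul_d x b S)].

Lemma koszul_mod_zero i : koszul_mod_neq0 [set 0] i -> koszul_homology_neq0 x i.
Proof.
move=> [c [dc c0 cb]]; exists c; split.
  by split=> //; apply/ffunP => S; rewrite [RHS]ffunE; exact: c0.
by case=> b db E; apply: (cb b db) => S; rewrite /= {1}E subrr.
Qed.

(** The top homology is the annihilator of [x] in [A / J]: [a] times the top basis element is a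
    cycle, and degree [n] has no nonzero boundaries. *)
Lemma koszul_mod_socle (J : set A) a : ideal J -> (forall i, J (x i * a)) -> ~ J a ->
  koszul_mod_neq0 J n.
Proof.
move=> IJ Ja nJa; exists [ffun S => if S == [set: 'I_n]%SET then a else 0]; split.
- move=> S; rewrite ffunE; case: (altP (S =P [set: 'I_n]%SET)) => [-> _|_ /eqP//].
  by rewrite cardsT card_ord.
- move=> S; rewrite koszul_dE; apply: (ideal_sum IJ) => j _.
  rewrite ffunE; case: ifP => _; last by rewrite mulr0; apply: ideal0.
  by rewrite -mulrA; apply: ideal_mull.
- move=> b db /(_ [set: 'I_n]%SET); rewrite ffunE eqxx koszul_dE big1 ?subr0 //.
  by move=> j; rewrite inE.
Qed.

(* The relevant piece of the long exact sequence of
   [0 -> A/J -(y)-> A/J -> A/(J + y) -> 0]. *)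
Lemma koszul_mod_regular (J : set A) y i : ideal J -> (forall a, J (y * a) -> J a) ->
  koszul_mod_neq0 (iadd J (princ y)) i ->
  koszul_mod_neq0 J i \/ exists2 k, i = k.+1 & koszul_mod_neq0 J k.
Proof.
move=> IJ yreg [c [dc Jc cb]].
have [|no] := pselect (koszul_mod_neq0 J i); [by left | right].
have boundary c' : koszul_degree i c' -> (forall S, J (koszul_d x c' S)) ->
    exists2 b, koszul_degree i.+1 b & forall S, J (c' S - koszul_d x b S).
  move=> dc' Jc'; apply: contrapT => nob; apply: no; exists c'; split=> // b db Hb.
  by apply: nob; exists b.
have Jadd : J `<=` iadd J (princ y) by apply: iadd_subl; apply: princ_ideal.
case: i => [|i] in dc cb boundary no *.
  have [S|b db Hb] := boundary c dc; last by case: (cb b db) => S; apply: Jadd.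
  rewrite koszul_dE big1 => [|j jS]; first exact: ideal0.
  rewrite (_ : c _ = 0) ?mulr0 //; apply: contraTeq isT => /dc.
  by rewrite cardsU1 jS.
exists i => //.
(* The connecting map: modulo [J] the boundary of [c] is divisible by [y], and the quotient [e] is
   the class sought. It is put to 0 outside degree [i] so as to be homogeneous. *)
have /choice[e0 He0] S : exists e, J (koszul_d x c S - y * e) /\ (e != 0 -> #|S| = i).
  have [eqi|neqi] := eqVneq #|S| i; last first.
    exists 0; rewrite eqxx mulr0 subr0 (_ : koszul_d x c S = 0); first by split; first exact: ideal0.
    by apply: contra_neq_eq neqi => /(koszul_degree_d dc).
  have [u [_ [Ju [e ->] ->]]] := Jc S; exists e; split=> //.
  by rewrite [y * e]mulrC addrK.
pose e : {ffun {set 'I_n} -> A} := [ffun S => e0 S].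
have eE S : e S = e0 S by rewrite ffunE.
have He S : J (koszul_d x c S - y * e S) by rewrite eE; have [] := He0 S.
have de : koszul_degree i e by move=> S; rewrite eE; have [_] := He0 S; apply.
exists e; split=> // [S|f df Hf].
  apply: yreg; rewrite -[_ * _]opprK; apply: idealN => //.
  have <- : koszul_d x [ffun S => koszul_d x c S - y * e S] S = - (y * koszul_d x e S).
    by rewrite koszul_d_comb koszul_dd [X in X - _]ffunE sub0r.
  by apply: koszul_d_ideal => // T; rewrite [X in J X]ffunE.
(* If [e] is the boundary of [f] modulo [J], then [c - y f] is a cycle, hence a boundary modulo [J],
   which makes [c] a boundary modulo [J + (y)]. *)
pose g : {ffun {set 'I_n} -> A} := [ffun S => c S - y * f S].
have gE S : g S = c S - y * f S by rewrite ffunE.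
have [S|S|b db Hb] := boundary g.
- rewrite gE => H; have [cS|/dc //] := eqVneq (c S) 0.
  by apply: df; apply: contraNneq H => ->; rewrite cS mulr0 subr0.
- rewrite koszul_d_comb (_ : _ - _ = (koszul_d x c S - y * e S) +
    y * (e S - koszul_d x f S)); last by ring.
  by apply: idealD => //; apply: ideal_mull.
case: (cb b db) => S; have := Hb S; rewrite gE => JS.
exists (c S - y * f S - koszul_d x b S), (f S * y); split=> //; first by exists (f S).
by ring.
Qed.

End KoszulComplex.

(** * Depth is at most dimension in a Noetherian local ring *)

Section DepthDimension.
Variable R : localRing.
Hypothesis NR : noetherian R.
Local Notation m := (maxid R).
Implicit Types (J P Q : set R).

Fixpoint coheight_ge n Q : Prop :=
  if n is n'.+1 then prime_ideal Q /\ exists2 Q', Q `<` Q' & coheight_ge n' Q'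
  else prime_ideal Q.

Lemma coheight_ge_prime n Q : coheight_ge n Q -> prime_ideal Q.
Proof. by case: n => [|n] // []. Qed.

Lemma coheight_height a b Q : height_ge a Q -> coheight_ge b Q -> height_ge (a + b) m.
Proof.
elim: b a Q => [|b IH] a Q Ha /=.
  move=> PQ; rewrite addn0; apply: height_geS Ha; first exact: maxid_prime.
  exact: prime_sub_maxid.
move=> [PQ [Q' QQ' HQ']]; rewrite addnS -addSn; apply: (IH _ Q') => //=.
by split; [exact: coheight_ge_prime HQ' | exists Q].
Qed.

(* The maximal ideals among the [(J : a)] with [a] not in [J] are finite in
   number: they are the [(J : a_i)] for generators [a_i] of the ideal generated
   by all these [a]. *)
Lemma regular_exists J : ideal J -> J `<=` m ->
  (forall a, (forall p, m p -> J (p * a)) -> J a) ->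
  exists2 y, m y & forall a, J (y * a) -> J a.
Proof.
move=> IJ Jm nosocle.
pose good a := [/\ ~ J a, prime_ideal (colon J a) & forall b, ~ J b ->
  colon J a `<=` colon J b -> colon J b = colon J a].
have good_exists b : ~ J b -> exists2 a, good a & colon J b `<=` colon J a.
  move=> Jb.
  have [||_ [[a Ja ->] ba amax]] :=
    @noetherian_max _ (fun I => exists2 a, ~ J a & I = colon J a) (colon J b) NR.
  - by move=> _ [a _ ->]; apply: colon_ideal.
  - by exists b.
  exists a => //; split=> //; last by move=> c Jc; apply: amax; exists c.
  have [|s t -> ->|s ->|a' [aa' Pa' Ja']] := @colon_prime _ [set 1] J a NR IJ.
  - by [].
  - by rewrite /= mulr1.
  - by rewrite mul1r.
  rewrite -(amax (colon J a')) //; exists a' => // J1; apply: (Ja' 1) => //.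
  by rewrite mul1r.
pose V (l : seq R) := foldr (fun a U => iadd U (princ a)) [set 0] l.
have IV l : ideal (V l).
  elim: l => [|a l IH] /=; first exact: ideal_zero.
  by apply: iadd_ideal => //; apply: princ_ideal.
have [||_ [[l lgood ->] _ lmax]] := @noetherian_max _
    (fun I => exists2 l, (forall a, a \in l -> good a) & I = V l) (V [::]) NR.
- by move=> _ [l _ ->]; apply: IV.
- by exists [::].
have in_l a : good a -> exists2 a', a' \in l & colon J a' = colon J a.
  move=> gooda; have [Ja Pa amax] := gooda.
  have Vla : V l a.
    rewrite -(lmax (V (a :: l))) /=.
    - by apply: iadd_subr; [exact: IV | exact: princ_id].
    - by exists (a :: l) => // b; rewrite in_cons => /orP[/eqP -> //|/lgood].
    - by apply: iadd_subl; apply: princ_ideal.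
  apply: contrapT => no.
  (* If [(J : a)] is not in the list, some [z] outside it lies in all the listed primes. But then
     [z] multiplies [V l] into [J], and [a] is in [V l]. *)
  have [Q|z az lz] := @prime_inter_notin _ (colon J a) (map (colon J) l) Pa.
    move=> /mapP[a' a'l ->]; split; first exact: colon_ideal.
    by move=> s; apply: no; exists a' => //; have [_ _ H] := lgood _ a'l; rewrite (H a).
  apply: az; suff H : V l `<=` colon J z by rewrite /colon /= mulrC; apply: H.
  elim: (l) lz => [|b l' IH] lz /=.
    by move=> _ ->; rewrite /colon /= mul0r; apply: ideal0.
  apply: iadd_sub; first exact: colon_ideal.
    by apply: IH => Q Ql; apply: lz; rewrite in_cons Ql orbT.
  apply: princ_sub; first exact: colon_ideal.
  by rewrite /colon /= mulrC; apply: (lz (colon J b)); rewrite mem_head.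
have [Q|y my ly] := @prime_avoidance _ m (map (colon J) l) (maxid_ideal R).
  move=> /mapP[a /lgood[Ja Pa _] ->]; split=> // sm; apply: Ja.
  by apply: nosocle.
exists y => // a Jya; apply: contrapT => /good_exists[b gb sb].
have [b' b'l E] := in_l _ gb; apply: (ly (colon J b')); first exact: map_f.
by rewrite E; apply: sb.
Qed.

(** A regular element lowers the dimension. Products of an element outside [Q] with a power of [y]
    avoid [J], and [colon_prime] for this multiplicative set gives a prime inside [Q] that misses
    [y]. *)
Lemma regular_coheight J y Q l : ideal J -> (forall a, J (y * a) -> J a) ->
  iadd J (princ y) `<=` Q -> coheight_ge l Q ->
  exists2 P, J `<=` P & coheight_ge l.+1 P.
Proof.
move=> IJ yreg yQ HQ; have PQ := coheight_ge_prime HQ.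
have yn i a : J (a * y ^+ i) -> J a.
  by elim: i => [|i IHi]; rewrite ?mulr1 // exprS mulrCA => /yreg.
have JQ : J `<=` Q by apply: subset_trans yQ; apply: iadd_subl; apply: princ_ideal.
have Qy : Q y by apply: yQ; apply: iadd_subr => //; apply: princ_id.
pose S := [set z | exists s i, ~ Q s /\ z = s * y ^+ i].
have S1 s : ~ Q s -> S s by move=> Qs; exists s, 0%N; rewrite mulr1.
have [||_ [s [i [Qs ->]]]|a [_ Pa Sa]] := @colon_prime _ S J 1 NR IJ.
- exact/S1/prime1.
- move=> _ _ [s [i [Qs ->]]] [t [j [Qt ->]]]; exists (s * t), (i + j)%N.
  by split; [exact: primeNM | rewrite exprD; ring].
- by rewrite mulr1 => /yn /JQ.
exists (colon J a); first exact: colon_sub.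
split=> //; exists Q => //; split.
  by move=> s Js; apply: contrapT => /S1 /Sa.
move=> /(_ y Qy); apply: Sa; exists 1, 1%N; rewrite mul1r.
by split=> //; apply: prime1.
Qed.

(** Induction on the bound [k] for the dimension of [R / J]. If the socle is nonzero, there is
    homology in degree [n]; otherwise adding a regular [y] to [J] lowers the bound by one and costs
    at most one homological degree. *)
Lemma koszul_mod_dim n (x : 'I_n -> R) k J : m = ideal_gen (range x) ->
  ideal J -> J `<=` m -> (forall Q l, J `<=` Q -> coheight_ge l Q -> (l <= k)%N) ->
  exists2 i, (n <= i + k)%N & koszul_mod_neq0 x J i.
Proof.
move=> mE; elim: k.+1 {-2}k (ltnSn k) J => // {}k IH k' k'k J IJ Jm Hk.
have [[a Ja ma]|nosocle] := pselect (exists2 a, ~ J a & forall p, m p -> J (p * a)).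
  exists n; first exact: leq_addr.
  by apply: (koszul_mod_socle (a := a)) => // i; apply: ma; rewrite mE; apply: ideal_gen_range.
have [a Ha|y my yreg] := @regular_exists J IJ Jm.
  by apply: contrapT => Ja; apply: nosocle; exists a.
have Im := maxid_ideal R.
have sm : iadd J (princ y) `<=` m by apply: iadd_sub => //; apply: princ_sub.
have [P JP HP] := @regular_coheight J y m 0 IJ yreg sm (maxid_prime R).
case: k' k'k Hk (Hk _ _ JP HP) => // k' k'k Hk _.
have [||Q l yQ HQ|i ni Hi] := IH k' _ (iadd J (princ y)) _ sm.
- by [].
- by apply: iadd_ideal => //; apply: princ_ideal.
- by have [P' JP' HP'] := regular_coheight IJ yreg yQ HQ; have := Hk _ _ JP' HP'.
have [?|[j E Hj]] := koszul_mod_regular IJ yreg Hi.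
  by exists i => //; rewrite addnS; apply: leqW.
by exists j => //; rewrite addnS -addSn -E.
Qed.

Lemma koszul_homology_dim n (x : 'I_n -> R) d : m = ideal_gen (range x) ->
  krull_dim R = Some d -> exists2 i, (n <= i + d)%N & koszul_homology_neq0 x i.
Proof.
move=> mE /krull_dimP[_ Hd].
have [||Q l _ HQ|i ni Hi] := @koszul_mod_dim n x d [set 0] mE.
- exact: ideal_zero.
- by move=> _ ->; apply: ideal0 (maxid_ideal R).
- by apply: Hd; apply: (@coheight_height 0 _ Q) => //; apply: coheight_ge_prime HQ.
- by exists i => //; apply: koszul_mod_zero.
Qed.

End DepthDimension.

(** * Ultrafilters: finite pigeonhole, choice, countable saturation *)

Section Filters.
Variables (W : Type) (U : set_system W) (HU : UltraFilter U).

Lemma near_not (P : W -> Prop) : ~ (\forall w \near U, P w) -> \forall w \near U, ~ P w.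
Proof. by move=> nP; have [|//] := in_ultra_setVsetC [set w | P w] HU. Qed.

Lemma near_forall_ltn n (P : nat -> W -> Prop) :
  (forall i, (i < n)%N -> \forall w \near U, P i w) ->
  \forall w \near U, forall i, (i < n)%N -> P i w.
Proof.
elim: n => [|n IH] H; first by apply: nearW.
have H1 := H n (leqnn _); have H2 := IH (fun i ilt => H i (leqW ilt)).
by apply: filterS2 H1 H2 => w Pn Plt i; rewrite ltnS leq_eqVlt => /orP[/eqP ->|/Plt].
Qed.

Lemma near_bounded n (Q : nat -> W -> Prop) :
  (\forall w \near U, exists2 d, (d <= n)%N & Q d w) ->
  exists d, \forall w \near U, Q d w.
Proof.
move=> H; apply: contrapT => /forallNP no.
have H' : \forall w \near U, forall d, (d < n.+1)%N -> ~ Q d w.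
  by apply: near_forall_ltn => d _; exact: near_not.
by have [w [[d dn Qd] /(_ d dn)]] := filter_ex (filterI H H').
Qed.

Lemma near_choice (X : W -> Type) (x0 : forall w, X w) (Q : forall w, X w -> Prop) :
  (\forall w \near U, exists x, Q w x) -> exists f : forall w, X w, \forall w \near U, Q w (f w).
Proof.
move=> H; have ex w : exists x : X w, (exists x, Q w x) -> Q w x.
  by have [[x Qx]|no] := pselect (exists x, Q w x); [exists x | exists (x0 w)].
exists (fun w => projT1 (cid (ex w))); apply: filterS H => w Hw.
by case: cid => x /=; apply.
Qed.

Hypothesis U_incomplete : countably_incomplete U.

(** At [w], as many of the nested conditions as possible are met: all those before the first [n]
    such that [w] is outside [A n] or [Q n w] has no solution. Such an [n] exists for almost all
    [w], because the intersection of the [A n] is not in [U]; if it is 0, the default [x0] is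
    taken. *)
Lemma saturation (X : W -> Type) (x0 : forall w, X w) (Q : nat -> forall w, X w -> Prop) :
  (forall n w x, Q n.+1 w x -> Q n w x) ->
  (forall n, \forall w \near U, exists x, Q n w x) ->
  exists f : forall w, X w, forall n, \forall w \near U, Q n w (f w).
Proof.
move=> Qmono QU; have [A [UA nUA]] := U_incomplete.
have Qle w x i j : (i <= j)%N -> Q j w x -> Q i w x.
  by move=> /subnK <-; elim: (j - i)%N => [//|k IH]; rewrite addSn => /Qmono.
pose good n w := A n w /\ exists x, Q n w x.
have good_near n : \forall w \near U, forall i, (i < n.+1)%N -> good i w.
  by apply: near_forall_ltn => i _; have := QU i; apply: filterS2 (UA i) => w; split.
have bad_near : \forall w \near U, ~ (\bigcap_n A n) w by apply: near_not.
have [f Hf] : exists f : forall w, X w, forall w, ~ (\bigcap_n A n) w ->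
    forall n, (forall i, (i < n.+1)%N -> good i w) -> Q n w (f w).
  suff ex w : exists x : X w, ~ (\bigcap_n A n) w ->
      forall n, (forall i, (i < n.+1)%N -> good i w) -> Q n w x.
    by exists (fun w => projT1 (cid (ex w))) => w; case: cid.
  have [/asboolP Aw|nA] := boolP `[< (\bigcap_n A n) w >]; first by exists (x0 w).
  have bad : exists n, `[< ~ good n w >].
    apply: contrapT => no; move/asboolP: nA; apply=> n _.
    by have [] : good n w by apply: contrapT => ng; apply: no; exists n; apply/asboolP.
  case: (ex_minnP bad) => -[|N] /asboolP Nbad Nmin.
    by exists (x0 w) => _ n /(_ 0%N isT).
  have [_ [x Qx]] : good N w.
    by apply: contrapT => /asboolP/Nmin; rewrite ltnn.
  exists x => _ n Hn; apply: Qle Qx; rewrite leqNgt; apply/negP => Nn.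
  by apply: Nbad; apply: Hn; rewrite ltnS.
by exists f => n; apply: filterS2 bad_near (good_near n) => w nA; apply: Hf.
Qed.

End Filters.

(** * The theorem of Los for ideals, and quasi-completeness *)

Section UltraLos.
Variables (W : Type) (U : set_system W) (HU : UltraFilter U) (R : W -> localRing).
Local Notation P := (ultra_prod HU R).
Local Notation Rn := (ultraproduct HU R).
Local Notation cls := (@ultra_class W U HU R).
Implicit Types (f g h : P) (I J : forall w, set (R w)).

Lemma ultra_surj (z : Rn) : exists f, z = cls f.
Proof. exact: quot_pi_surj. Qed.

Lemma ultra_surj_fun (T : Type) (z : T -> Rn) : exists f : T -> P, forall t, z t = cls (f t).
Proof. by have [f Hf] := choice (fun t => ultra_surj (z t)); exists f. Qed.

Lemma ultra_eq f g : cls f = cls g <-> \forall w \near U, f w = g w.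
Proof.
split=> [/quot_piE H|H]; last apply/quot_piE.
  by apply: filterS H => w /eqP; rewrite subr_eq0 => /eqP.
by apply: filterS H => w E; apply/eqP; rewrite subr_eq0; apply/eqP.
Qed.

Lemma ultra_sumE (T : Type) (r : seq T) (p : pred T) (F : T -> P) w :
  (\sum_(i <- r | p i) F i) w = \sum_(i <- r | p i) F i w.
Proof. by rewrite (big_morph (fun f : P => f w) (id1 := 0) (op1 := +%R)). Qed.

Lemma ultra_sum (T : Type) (r : seq T) (p : pred T) (F : T -> P) :
  cls (\sum_(i <- r | p i) F i) = \sum_(i <- r | p i) cls (F i).
Proof.
apply: (big_morph cls) => [f g|]; first exact: quot_piD.
exact: quot_pi0.
Qed.

Definition uset I : set Rn := [set cls f | f in [set f | \forall w \near U, I w (f w)]].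

Lemma usetE I f : uset I (cls f) <-> \forall w \near U, I w (f w).
Proof.
split=> [[g gI] /ultra_eq gf|fI]; last by exists f.
by apply: filterS2 gI gf => w gw <-.
Qed.

Lemma uset_maxid : uset (fun w => maxid (R w)) = maxid Rn.
Proof. by []. Qed.

Lemma uset_sub I J : uset I `<=` uset J <-> \forall w \near U, I w `<=` J w.
Proof.
split=> [s|s _ [f fI <-]]; last first.
  by apply/usetE; apply: filterS2 s fI => w sw /sw.
apply: contrapT => /(near_not HU) H.
have [|f Hf] := @near_choice W U HU R (fun=> 0) (fun w x => I w x /\ ~ J w x).
  by apply: filterS H => w /existsNP[x /not_implyP]; exists x.
have /s/usetE Jf : uset I (cls f) by apply/usetE; apply: filterS Hf => w [].
by have [w [[_ nJ] /nJ]] := filter_ex (filterI Hf Jf).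
Qed.

Lemma uset_eq I J : (\forall w \near U, I w = J w) -> uset I = uset J.
Proof.
by move=> H; apply/seteqP; split; apply/uset_sub; apply: filterS H => w ->.
Qed.

Lemma uset_proper I J : uset I `<` uset J <-> \forall w \near U, I w `<` J w.
Proof.
split=> [[/uset_sub s ns]|s].
  have : ~ \forall w \near U, J w `<=` I w by move=> /uset_sub.
  by move=> /(near_not HU); apply: filterS2 s.
split; first by apply/uset_sub; apply: filterS s => w [].
by move=> /uset_sub ns; have [w [[_ H]]] := filter_ex (filterI s ns).
Qed.

Lemma uset_ideal I : (\forall w \near U, ideal (I w)) -> ideal (uset I).
Proof.
move=> II; split.
- rewrite -(quot_pi0 (almost_zero_pideal HU R)); apply/usetE.
  by apply: filterS II => w; apply: ideal0.
- move=> _ _ [f fI <-] [g gI <-]; rewrite -quot_piD; apply/usetE.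
  by apply: filterS3 II fI gI => w; apply: idealD.
- move=> a _ [f fI <-]; have [b ->] := ultra_surj a; rewrite -quot_piM; apply/usetE.
  by apply: filterS2 II fI => w IIw; apply: (ideal_mull IIw).
Qed.

Lemma uset_prime I : (\forall w \near U, ideal (I w)) ->
  prime_ideal (uset I) <-> \forall w \near U, prime_ideal (I w).
Proof.
move=> II; split=> [[[_ P1] PP]|PI]; last first.
  split.
    split; first exact: uset_ideal.
    rewrite -(quot_pi1 (almost_zero_pideal HU R)) => /usetE I1.
    by have [w [/prime1 H /H]] := filter_ex (filterI PI I1).
  move=> x y; have [f ->] := ultra_surj x; have [g ->] := ultra_surj y.
  rewrite -quot_piM => /usetE fg.
  have [/usetE|/(contra_not (usetE _ _).2)/(near_not HU) nf] := pselect (uset I (cls f)).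
    by move=> /usetE; left.
  by right; apply/usetE; apply: filterS3 PI fg nf => w Pw; apply: primeM.
have I1 : \forall w \near U, ~ I w 1.
  apply: near_not => H; apply: P1; rewrite -(quot_pi1 (almost_zero_pideal HU R)).
  exact/usetE.
apply: contrapT => /(near_not HU) H.
have [|f Hf] := @near_choice W U HU (fun w => (R w * R w)%type) (fun=> (0, 0))
    (fun w x => [/\ I w (x.1 * x.2), ~ I w x.1 & ~ I w x.2]).
  apply: filterS3 II I1 H => w IIw I1w nP; apply: contrapT => no; apply: nP.
  split=> // x y Ixy; apply: contrapT => /not_orP[Ix Iy]; apply: no.
  by exists (x, y).
have [] := PP (cls (fun w => (f w).1)) (cls (fun w => (f w).2)).
- by rewrite -quot_piM; apply/usetE; apply: filterS Hf => w [].
- by move=> /usetE If; have [w [[_ nf _] /nf]] := filter_ex (filterI Hf If).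
- by move=> /usetE If; have [w [[_ _ nf] /nf]] := filter_ex (filterI Hf If).
Qed.

Lemma uset_colon I f : colon (uset I) (cls f) = uset (fun w => colon (I w) (f w)).
Proof.
apply/seteqP; split=> z; have [g ->] := ultra_surj z; rewrite /colon /= -quot_piM.
  by move=> /usetE H; apply/usetE; apply: filterS H.
by move=> /usetE H; apply/usetE; apply: filterS H.
Qed.

(** Since [n] is the same for all [w], the coefficients chosen in the components assemble into [n]
    elements of [Rn]. *)
Lemma uset_comb n (g : 'I_n -> P) I f : (\forall w \near U,
    exists2 c : 'I_n -> R w, (forall i, I w (c i)) & f w = \sum_i c i * g i w) ->
  exists2 c : 'I_n -> Rn, (forall i, uset I (c i)) & cls f = \sum_i c i * cls (g i).
Proof.
move=> H; have [|c Hc] := @near_choice W U HU (fun w => 'I_n -> R w) (fun w _ => 0)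
  (fun w c => (forall i, I w (c i)) /\ f w = \sum_i c i * g i w).
  by apply: filterS H => w [c]; exists c.
exists (fun i => cls (fun w => c w i)) => [i|].
  by apply/usetE; apply: filterS Hc => w [].
under eq_bigr => i _ do rewrite -quot_piM -/(cls _).
rewrite -ultra_sum; apply/ultra_eq; apply: filterS Hc => w [_ ->].
by rewrite ultra_sumE.
Qed.

Lemma uset_gen n (g : 'I_n -> P) :
  ideal_gen (range (fun i => cls (g i))) =
  uset (fun w => ideal_gen (range (fun i => g i w))).
Proof.
have Igen : \forall w \near U, ideal (ideal_gen (range (fun i => g i w))).
  by apply: nearW => w; apply: ideal_gen_ideal.
apply/seteqP; split.
  apply: ideal_gen_range_sub => [|i]; first exact: uset_ideal.
  by apply/usetE; apply: nearW => w; apply: (@ideal_gen_range _ n (fun i => g i w)).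
move=> _ [f fI <-]; apply/ideal_gen_rangeP.
have [|c _ E] := @uset_comb n g (fun=> setT) f; last by exists c.
by apply: filterS fI => w /ideal_gen_rangeP[c E]; exists c.
Qed.

Lemma uset_iprod n (g : 'I_n -> P) I : (\forall w \near U, ideal (I w)) ->
  iprod (ideal_gen (range (fun i => cls (g i)))) (uset I) =
  uset (fun w => iprod (ideal_gen (range (fun i => g i w))) (I w)).
Proof.
move=> II; apply/seteqP; split.
  apply: iprod_sub.
    by apply: uset_ideal; apply: nearW => w; apply: iprod_ideal.
  move=> a b; rewrite uset_gen => -[f fI <-] [h hI <-].
  rewrite -quot_piM; apply/usetE; apply: filterS2 fI hI => w; exact: iprod_mem.
move=> _ [f fI <-].
have [|c cI ->] := @uset_comb n g I f.
  apply: filterS2 II fI => w IIw; rewrite iprodC => /(iprod_genP _ _ IIw)[c ? ?].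
  by exists c.
rewrite iprodC; apply/iprod_genP; first exact: uset_ideal.
by exists c.
Qed.

(** Without finitely many generators, elements of the powers in the components could need ever more
    summands. Generators of [maxid Rn] generate the maximal ideal of almost every component, and
    [uset_iprod] adds one factor at a time. *)
Lemma uset_pow k : fin_gen (maxid Rn) ->
  ideal_pow (maxid Rn) k = uset (fun w => ideal_pow (maxid (R w)) k).
Proof.
move=> [n [x mE]]; have [g Hg] := ultra_surj_fun x.
have {}mE : maxid Rn = ideal_gen (range (fun i => cls (g i))).
  by rewrite mE (_ : x = fun i => cls (g i)) //; exact/funext.
have mEw : \forall w \near U, maxid (R w) = ideal_gen (range (fun i => g i w)).
  have /seteqP[/uset_sub s1 /uset_sub s2] :
      uset (fun w => maxid (R w)) = uset (fun w => ideal_gen (range (fun i => g i w))).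
    by rewrite uset_maxid mE uset_gen.
  by apply: filterS2 s1 s2 => w ? ?; apply/seteqP.
elim: k => [|k IH].
  rewrite ideal_pow0; apply/seteqP; split=> // z _; have [f ->] := ultra_surj z.
  by apply/usetE; apply: nearW => w; rewrite ideal_pow0.
rewrite ideal_powS IH mE uset_iprod; last by apply: nearW => w; apply: ideal_pow_ideal.
by apply: uset_eq; apply: filterS mEw => w Ew; rewrite ideal_powS -Ew.
Qed.

Hypothesis R_bounded : exists b : nat, \forall w \near U, enat_le (embdim (R w)) (Some b).

Lemma ultra_bounded_gen : exists n, \forall w \near U, generated_by n (maxid (R w)).
Proof.
have [b Hb] := R_bounded; exists b; apply: filterS Hb => w.
case E : (embdim (R w)) => [d|] //= db; have [Hd _] := enat_min_some E.
exact: generated_by_leq Hd.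
Qed.

Lemma ultra_maxid_fin_gen : fin_gen (maxid Rn).
Proof.
have [n Hn] := ultra_bounded_gen; exists n.
have [|x Hx] := @near_choice W U HU (fun w => 'I_n -> R w) (fun w _ => 0)
    (fun w x => maxid (R w) = ideal_gen (range x)).
  by apply: filterS Hn => w [x]; exists x.
exists (fun i => cls (fun w => x w i)); rewrite uset_gen -uset_maxid.
exact: uset_eq.
Qed.

Lemma uset_maxid_pow k : ideal_pow (maxid Rn) k = uset (fun w => ideal_pow (maxid (R w)) k).
Proof. by apply: uset_pow; apply: ultra_maxid_fin_gen. Qed.

Hypothesis U_incomplete : countably_incomplete U.

(** Saturation for coefficient vectors: for each [k] some vector has its error in the [k]-th power,
    so one vector works for all [k] and leaves an infinitesimal error. *)
Lemma fin_gen_closure (J : set Rn) y : fin_gen J ->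
  (forall k, iadd J (ideal_pow (maxid Rn) k) y) -> iadd J (infinitesimal Rn) y.
Proof.
move=> [r [x ->]] Hy; have [g Hg] := ultra_surj_fun x; have [h Hh] := ultra_surj y.
rewrite Hh in Hy *; rewrite (_ : x = fun i => cls (g i)) in Hy *; last exact/funext.
have [|k|c Hc] := @saturation W U HU U_incomplete (fun w => 'I_r -> R w) (fun w _ => 0)
    (fun k w c => ideal_pow (maxid (R w)) k (h w - \sum_i c i * g i w)).
- by move=> k w c; apply: ideal_powS_sub.
- have [a [b [aJ]]] := Hy k; rewrite uset_maxid_pow uset_gen in aJ *.
  case: aJ => f fJ <- [e eP <-]; rewrite -quot_piD => /ultra_eq E.
  apply: filterS3 fJ eP E => w /ideal_gen_rangeP[c Ec] eP E; exists c.
  by rewrite -Ec E (_ : _ - _ = e w) // [X in X - _](_ : _ = f w + e w) // addrAC subrr add0r.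
pose c' i := cls (fun w => c w i).
have sE : \sum_i c' i * cls (g i) = cls (fun w => \sum_i c w i * g i w).
  under eq_bigr => i _ do rewrite -quot_piM -/(cls _).
  rewrite -ultra_sum; apply/ultra_eq; apply: nearW => w.
  by rewrite ultra_sumE.
exists (\sum_i c' i * cls (g i)), (cls h - \sum_i c' i * cls (g i)); split.
- by apply/ideal_gen_rangeP; exists c'.
- by move=> k _; rewrite sE uset_maxid_pow -quot_piB; apply/usetE; exact: Hc.
- by rewrite addrC subrK.
Qed.

(** Saturation again: the conditions on the limit up to index [k] are met by [r k] itself. *)
Lemma cauchy_limit (r : nat -> Rn) :
  (forall k, ideal_pow (maxid Rn) k.+1 (r k.+1 - r k)) ->
  exists y, forall k, ideal_pow (maxid Rn) k.+1 (y - r k).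
Proof.
move=> Hr; have [h Hh] := ultra_surj_fun r.
have Hr' k i : (i < k.+1)%N -> ideal_pow (maxid Rn) i.+1 (r k - r i).
  rewrite ltnS => /subnK <-; elim: (k - i)%N => [|j IH].
    by rewrite subrr; apply: ideal0 (ideal_pow_ideal _ _).
  rewrite addSn -(subrK (r (j + i)%N) (r _)) -addrA.
  apply: (idealD (ideal_pow_ideal _ _)) => //.
  by apply: ideal_pow_leq (Hr (j + i)%N); rewrite ltnS leq_addl.
have [|k|y Hy] := @saturation W U HU U_incomplete (fun w => R w) (fun w => 0)
    (fun k w y => forall i, (i < k.+1)%N -> ideal_pow (maxid (R w)) i.+1 (y - h i w)).
- by move=> k w y H i ik; apply: H; apply: leqW.
- have : \forall w \near U, forall i, (i < k.+1)%N ->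
      ideal_pow (maxid (R w)) i.+1 (h k w - h i w).
    apply: near_forall_ltn => i ik; have := Hr' _ _ ik.
    by rewrite !Hh -quot_piB uset_maxid_pow => /usetE.
  by apply: filterS => w Hw; exists (h k w).
exists (cls y) => k; rewrite Hh -quot_piB uset_maxid_pow; apply/usetE.
by apply: filterS (Hy k) => w; apply.
Qed.

End UltraLos.

Arguments uset {W U} HU {R} I.

(** * Ideals under a surjective ring map, for quotients and for the completion *)

Section Surjections.
Variables (A B : comNzRingType) (phi : A -> B).
Hypothesis phiD : forall x y, phi (x + y) = phi x + phi y.
Hypothesis phiM : forall x y, phi (x * y) = phi x * phi y.
Hypothesis phi1 : phi 1 = 1.
Hypothesis phi_surj : forall z, exists x, z = phi x.
Implicit Types (I P : set A) (J Q : set B).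

Local Lemma phi0 : phi 0 = 0.
Proof. by apply: (addrI (phi 0)); rewrite -phiD !addr0. Qed.

Local Lemma phiB x y : phi (x - y) = phi x - phi y.
Proof. by apply: (addIr (phi y)); rewrite -phiD !subrK. Qed.

Lemma preimage_ideal J : ideal J -> ideal (phi @^-1` J).
Proof.
move=> IJ; split; rewrite /preimage /=.
- by rewrite phi0; apply: ideal0.
- by move=> x y; rewrite phiD; apply: idealD.
- by move=> a x; rewrite phiM; apply: ideal_mull.
Qed.

Lemma preimage_prime Q : prime_ideal Q -> prime_ideal (phi @^-1` Q).
Proof.
move=> PQ; split; first split.
- exact/preimage_ideal/prime_idealW.
- by rewrite /preimage /= phi1; apply: prime1.
- by move=> x y; rewrite /preimage /= phiM; apply: PQ.2.
Qed.

Lemma image_ideal I : ideal I -> ideal (phi @` I).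
Proof.
move=> II; split.
- by exists 0; [exact: ideal0 | exact: phi0].
- by move=> _ _ [x Ix <-] [y Iy <-]; exists (x + y); [exact: idealD | exact: phiD].
- move=> a _ [x Ix <-]; have [b ->] := phi_surj a.
  by exists (b * x); [exact: ideal_mull | exact: phiM].
Qed.

Lemma image_memE I x : ideal I -> (phi @^-1` [set 0]) `<=` I -> (phi @` I) (phi x) <-> I x.
Proof.
move=> II KI; split=> [[y Iy E]|Ix]; last by exists x.
rewrite -(subrK y x); apply: idealD => //; apply: KI.
by rewrite /preimage /= phiB E subrr.
Qed.

Lemma image_prime P : (phi @^-1` [set 0]) `<=` P -> prime_ideal P -> prime_ideal (phi @` P).
Proof.
move=> KP PP; have IP := prime_idealW PP; split; first split.
- exact: image_ideal.
- by rewrite -phi1 => /(image_memE _ IP KP); apply: prime1.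
- move=> a b; have [x ->] := phi_surj a; have [y ->] := phi_surj b.
  by rewrite -phiM !(image_memE _ IP KP); apply: PP.2.
Qed.

Lemma image_gen n (x : 'I_n -> A) :
  phi @` ideal_gen (range x) = ideal_gen (range (fun i => phi (x i))).
Proof.
apply/seteqP; split; last first.
  apply: ideal_gen_range_sub; first exact/image_ideal/ideal_gen_ideal.
  by move=> i; exists (x i) => //; apply: ideal_gen_range.
have IG : ideal (phi @^-1` ideal_gen (range (fun i => phi (x i)))).
  exact/preimage_ideal/ideal_gen_ideal.
move=> _ [y Hy <-]; move: y Hy; apply: (ideal_gen_range_sub IG) => i.
exact: (@ideal_gen_range _ n (fun i => phi (x i))).
Qed.

Lemma image_iprod I I' : phi @` iprod I I' = iprod (phi @` I) (phi @` I').
Proof.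
apply/seteqP; split.
  move=> _ [y Hy <-]; move: y Hy; pose K := phi @^-1` iprod (phi @` I) (phi @` I').
  apply: (@iprod_sub _ _ _ K); first exact/preimage_ideal/iprod_ideal.
  by move=> a b Ia Ib; rewrite /K /preimage /= phiM; apply: iprod_mem; [exists a | exists b].
apply: iprod_sub; first exact/image_ideal/iprod_ideal.
move=> _ _ [a Ia <-] [b Ib <-]; exists (a * b) => //; exact: iprod_mem.
Qed.

Lemma image_pow I n : phi @` ideal_pow I n = ideal_pow (phi @` I) n.
Proof.
elim: n => [|n IH]; last by rewrite !ideal_powS image_iprod IH.
rewrite !ideal_pow0; apply/seteqP; split=> // z _.
by have [x ->] := phi_surj z; exists x.
Qed.

Lemma image_fin_gen I : fin_gen I -> fin_gen (phi @` I).
Proof. by move=> [n [x ->]]; rewrite image_gen; apply: fin_gen_gen. Qed.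

Lemma lift_fun n (y : 'I_n -> B) : exists x : 'I_n -> A, y = fun i => phi (x i).
Proof.
have /choice[x Hx] i : exists x, y i = phi x by apply: phi_surj.
by exists x; apply/funext.
Qed.

Lemma lift_fin_gen J : fin_gen J -> exists2 I, fin_gen I & J = phi @` I.
Proof.
move=> [n [y ->]]; have [x ->] := lift_fun y.
by exists (ideal_gen (range x)); [exact: fin_gen_gen | rewrite image_gen].
Qed.

End Surjections.

(** * Artinian quotients of a local ring *)

Section ArtinianQuotient.
Variable R : localRing.
Local Notation m := (maxid R).
Hypothesis m_fin_gen : fin_gen m.
Variables (I : set R) (HI : pideal I).

Local Notation pi := (quot_pi HI).

Lemma quot_pi_ker : pi @^-1` [set 0] = I.
Proof.
apply/seteqP; split=> x; rewrite /preimage /= -(quot_pi0 HI).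
  by move=> /quot_piE; rewrite subr0.
by move=> Ix; apply/quot_piE; rewrite subr0.
Qed.

(** Once the chain [I + m^k] is stationary, [m^n] lies in [I + m^(n+1)] and Nakayama applies. The
    converse is [dcc_local] at the prime [m] with [s = 1]. *)
Lemma artinian_quot : artinian (quot_ring HI) <-> exists n, ideal_pow m n `<=` I.
Proof.
have [II I1] := HI.
have piD := quot_piD HI; have piM := quot_piM HI; have pi1 := quot_pi1 HI.
have pis := @quot_pi_surj _ _ HI.
split=> [art|[n mI] S IS mono]; last first.
  pose T k := pi @^-1` S k.
  have [|k|k|k x|k t a mt|k Hk] :=
    @dcc_local R m I 1 n T (maxid_prime R) m_fin_gen (prime1 (maxid_prime R)).
  - by move=> x /mI; rewrite /colon /= mulr1.
  - exact: preimage_ideal.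
  - rewrite -quot_pi_ker /T => x; rewrite /preimage /= => ->.
    exact: ideal0 (IS k).
  - exact: mono.
  - by apply: local_unitM => //; apply: preimage_ideal.
  exists k => j kj; apply/seteqP; split.
    have le : forall d, S (k + d)%N `<=` S k.
      by elim=> [|d IH]; rewrite ?addn0 // addnS; apply: subset_trans IH.
    by rewrite -(subnKC kj).
  by move=> z; have [x ->] := pis z; apply: (Hk j kj).
have IT k : ideal (iadd I (ideal_pow m k)) by apply: iadd_ideal => //; apply: ideal_pow_ideal.
have [k|k|n Hn] := art (fun k => pi @` iadd I (ideal_pow m k)).
- exact: image_ideal.
- apply: image_subset; apply: iadd_sub => //.
    by apply: iadd_subl; apply: ideal_pow_ideal.
  by apply: (subset_trans (@ideal_powS_sub _ m k)); apply: iadd_subr.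
exists n; apply: nakayama => //; first exact: fin_gen_pow.
rewrite -ideal_powS => x mx.
have : (pi @` iadd I (ideal_pow m n)) (pi x).
  by exists x => //; apply: iadd_subr.
rewrite -(Hn n.+1) // => /(image_memE piD _ (IT _)); apply.
by rewrite quot_pi_ker; apply: iadd_subl; apply: ideal_pow_ideal.
Qed.

End ArtinianQuotient.

(** * The completion of a quasi-complete local ring *)

Section CompletionMap.
Variable R : localRing.
Local Notation m := (maxid R).
Local Notation inf := (infinitesimal R).

Definition adic_seq (r : R) : adic_prod R := fun n => adic_pi n r.

Lemma adic_seq_compatible r : compatible (adic_seq r).
Proof. by apply/asboolP => n; exists r. Qed.

Definition to_completion (r : R) : completion R :=
  exist (fun x : adic_prod R => compatible x) (adic_seq r) (adic_seq_compatible r).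

Lemma to_completionD x y : to_completion (x + y) = to_completion x + to_completion y.
Proof. by apply/val_inj/functional_extensionality_dep => n; exact: quot_piD. Qed.

Lemma to_completionM x y : to_completion (x * y) = to_completion x * to_completion y.
Proof. by apply/val_inj/functional_extensionality_dep => n; exact: quot_piM. Qed.

Lemma to_completion1 : to_completion 1 = 1.
Proof. by apply/val_inj/functional_extensionality_dep => n; exact: quot_pi1. Qed.

Lemma to_completion_ker : to_completion @^-1` [set 0] = inf.
Proof.
apply/seteqP; split=> x.
  (* Component [n] is the quotient by the power [n.+1], so the power 0 is treated apart. *)
  move=> /(congr1 (@proj1_sig _ _)) E; case=> [|n] _; first by rewrite ideal_pow0.
  have /= := congr1 (fun f : adic_prod R => f n) E; rewrite /adic_seq /adic_pi.
  by rewrite -[RHS](quot_pi0 (pideal_pow n (maxid_maximal R).1)) => /quot_piE; rewrite subr0.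
move=> Hx; apply/val_inj/functional_extensionality_dep => n.
rewrite -[RHS](quot_pi0 (pideal_pow n (maxid_maximal R).1)); apply/quot_piE.
by rewrite subr0; apply: Hx.
Qed.

Hypothesis m_fin_gen : fin_gen m.
Hypothesis cauchy_limit : forall r : nat -> R,
  (forall k, ideal_pow m k.+1 (r k.+1 - r k)) ->
  exists y, forall k, ideal_pow m k.+1 (y - r k).
Hypothesis fin_gen_closure : forall (J : set R) y, fin_gen J ->
  (forall k, iadd J (ideal_pow m k) y) -> iadd J inf y.

Lemma to_completion_surj z : exists r, z = to_completion r.
Proof.
case: z => x Cx; have /asboolP Hx := Cx.
have /choice[r Hr] n : exists r, x n = adic_pi n r by exact: quot_pi_surj.
have [k|y Hy] := cauchy_limit (r := r).
  have [s [E1 E2]] := Hx k; rewrite -(subrK s (r k.+1)) -addrA.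
  apply: (idealD (ideal_pow_ideal _ _)).
    have /quot_piE : adic_pi k.+1 (r k.+1) = adic_pi k.+1 s by rewrite -Hr.
    exact: ideal_powS_sub.
  have /quot_piE // : adic_pi k s = adic_pi k (r k) by rewrite -Hr.
exists y; apply/val_inj/functional_extensionality_dep => n /=.
by rewrite Hr; apply/(quot_piE (pideal_pow n (maxid_maximal R).1)); rewrite -opprB; apply: (idealN (ideal_pow_ideal _ _)).
Qed.

Local Notation phi := to_completion.
Local Notation phiD := to_completionD.
Local Notation phiM := to_completionM.
Local Notation phi1 := to_completion1.
Local Notation phis := to_completion_surj.

Definition completion_maxid : set (completion R) := phi @` m.

Lemma completion_maxidE x : completion_maxid (phi x) <-> m x.
Proof.
apply: (image_memE phiD); first exact: maxid_ideal.
by rewrite to_completion_ker; apply: infinitesimal_maxid.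
Qed.

Lemma completion_maxid_pideal : pideal completion_maxid.
Proof.
split; first exact: (image_ideal phiD phiM phis (maxid_ideal R)).
by rewrite -phi1 => /completion_maxidE; apply: prime1; apply: maxid_prime.
Qed.

Lemma pideal_sub_completion_maxid (J : set (completion R)) : pideal J -> J `<=` completion_maxid.
Proof.
move=> [IJ J1] z; have [x ->] := phis z => Jx; apply/completion_maxidE.
apply: (@pideal_sub_maxid _ (phi @^-1` J)) => //.
by split; [exact: (preimage_ideal phiD phiM) | rewrite /preimage /= phi1].
Qed.

Lemma completion_maxid_maximal : maximal_ideal completion_maxid.
Proof.
split=> [|I pI mI]; first exact: completion_maxid_pideal.
by apply/seteqP; split=> //; apply: pideal_sub_completion_maxid.
Qed.

Lemma completion_maxid_unique (M : set (completion R)) :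
  maximal_ideal M -> M = completion_maxid.
Proof.
case=> pM Mmax; apply/esym/Mmax; first exact: completion_maxid_pideal.
exact: pideal_sub_completion_maxid.
Qed.

Definition completion_local : localRing :=
  LocalRing completion_maxid_maximal completion_maxid_unique.

(** Approximations pull back to [R], since the kernel [inf] lies in every power of [m]. Then
    [fin_gen_closure] puts a preimage of [z] in [J + inf], and [inf] maps to 0. *)
Lemma completion_closed (I : set (completion R)) z : fin_gen I ->
  (forall k, iadd I (ideal_pow completion_maxid k) z) -> I z.
Proof.
move=> /(lift_fin_gen phiD phiM phis)[J fJ ->] H.
have [x E] := phis z; rewrite E in H *.
suff [j [e [Jj He ->]]] : iadd J inf x.
  exists j => //; rewrite phiD [phi e](_ : _ = 0) ?addr0 //.
  by move: He; rewrite -to_completion_ker.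
apply: fin_gen_closure => // k; have [_ [b [[j Jj <-]]]] := H k.
rewrite -(image_pow phiD phiM phis) => -[p mp <-] Ex.
exists j, (x - j); split=> //; last by rewrite addrC subrK.
rewrite -(subrK p (x - j)); apply: (idealD (ideal_pow_ideal _ _)) => //.
suff : inf (x - j - p) by apply.
rewrite -to_completion_ker /preimage /= !(phiB phiD) Ex.
by ring.
Qed.

Lemma completion_noetherian : noetherian (completion R).
Proof.
apply: (complete_noetherian completion_maxid_maximal).
- exact: (image_fin_gen phiD phiM phis).
- by move=> I fI y; apply: completion_closed.
Qed.

Lemma closed_infinitesimal (P : set R) : P 0 -> adic_closed m P -> inf `<=` P.
Proof.
move=> P0 cP x xinf; apply: contrapT => /cP[n Hn]; apply: (Hn (- x)).
  by apply: (idealN (ideal_pow_ideal _ _)); apply: xinf.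
by rewrite subrr.
Qed.

(** Closed primes contain [inf], the kernel of [phi], so their images are prime. Conversely every
    ideal of the completion is finitely generated, hence closed, and so is its preimage. *)
Lemma closed_prime_chain n :
  prime_chain (adic_closed m) n <-> prime_chain (fun _ : set (completion R) => True) n.
Proof.
split=> [] [p [Hp plt]].
  have infp i : (i <= n)%N -> inf `<=` p i.
    move=> /Hp[/prime_idealW Ip cp]; apply: closed_infinitesimal => //; exact: ideal0.
  exists (fun i => phi @` p i); split=> [i ilt|i ilt].
    split=> //; apply: (image_prime phiD phiM phi1 phis); last exact: (Hp i ilt).1.
    by rewrite to_completion_ker; apply: infp.
  have [s ns] := plt i ilt; split; first exact: image_subset.
  move=> s'; apply: ns => x px; have : (phi @` p i) (phi x) by apply: s'; exists x.
  move=> /(image_memE phiD _ _); apply; first exact: prime_idealW (Hp i (ltnW ilt)).1.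
  by rewrite to_completion_ker; apply: infp; apply: ltnW.
exists (fun i => phi @^-1` p i); split=> [i ilt|i ilt].
  have [Pp _] := Hp i ilt; split; first exact: (preimage_prime phiD phiM phi1).
  move=> x px; apply: contrapT => /forallNP no; apply: px; rewrite /preimage /=.
  apply: completion_closed => [|k]; first exact/completion_noetherian/prime_idealW.
  have /existsNP[y /not_implyP[my /contrapT py]] := no k.
  exists (phi (x + y)), (phi (- y)); split=> //.
    rewrite -(image_pow phiD phiM phis); exists (- y) => //.
    exact: (idealN (ideal_pow_ideal _ _)).
  by rewrite -phiD addrK.
have [s ns] := plt i ilt; split; first by move=> x; apply: s.
by move=> s'; apply: ns => z; have [x ->] := phis z; apply: s'.
Qed.

Lemma cldim_cdim : cldim R = cdim R.
Proof.
by rewrite /cldim /cdim /krull_dim /chain_dim; congr enat_sup; apply/funext => n;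
  apply/propext/closed_prime_chain.
Qed.

Lemma gdim_set d : (exists (x : 'I_d -> R) (HI : pideal (ideal_gen (range x))),
    (forall i, m (x i)) /\ artinian (quot_ring HI)) <->
  exists x : 'I_d -> R, (forall i, m (x i)) /\
    exists n, ideal_pow m n `<=` ideal_gen (range x).
Proof.
split=> [[x [HI [mx /(artinian_quot m_fin_gen) H]]]|[x [mx H]]]; first by exists x.
have HI : pideal (ideal_gen (range x)).
  split=> [|/(ideal_gen_range_sub (maxid_ideal R) mx)]; first exact: ideal_gen_ideal.
  exact: prime1 (maxid_prime R).
by exists x, HI; split=> //; apply/(artinian_quot m_fin_gen).
Qed.

Lemma cdim_params e (x : 'I_e -> R) n : (forall i, m (x i)) ->
  ideal_pow m n `<=` ideal_gen (range x) -> exists2 d, cdim R = Some d & (d <= e)%N.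
Proof.
move=> mx mX; apply: (@krull_dim_params completion_local e (fun i => phi (x i)) n).
- exact: completion_noetherian.
- by move=> i; apply/completion_maxidE.
- rewrite -(image_gen phiD phiM phis) -(image_pow phiD phiM phis).
  exact: image_subset.
Qed.

Lemma cdim_embdim : exists2 d, cdim R = Some d & enat_le (cdim R) (embdim R).
Proof.
have [n Hn] := m_fin_gen.
have H e : generated_by e m -> exists2 d, cdim R = Some d & (d <= e)%N.
  move=> [x mE]; apply: (@cdim_params e x 1).
    by move=> i; rewrite mE; apply: ideal_gen_range.
  by rewrite -mE ideal_pow1 //; apply: maxid_ideal.
have [d E _] := H n Hn; exists d => //.
rewrite E; case Ee : (embdim R) => [e|//] /=.
have [/H[d' E' de] _] := enat_min_some Ee.
by move: E'; rewrite E => -[->].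
Qed.

Lemma gdim_cdim : gdim R = cdim R.
Proof.
have [d E _] := cdim_embdim; rewrite E; apply: enat_min_eq => [|k /gdim_set[x [mx [n mX]]]].
  apply/gdim_set.
  have [y my miny] := @params_exist completion_local d completion_noetherian E.
  have [x Ey] := lift_fun phis y; rewrite Ey in my miny.
  have mx i : m (x i) by apply/completion_maxidE; apply: my.
  exists x; split=> //.
  have [||n] := minimal_over_maxid_pow _ _ miny.
  - exact: completion_noetherian.
  - exact: ideal_gen_ideal.
  rewrite -(image_gen phiD phiM phis) -(image_pow phiD phiM phis) => H.
  have IG := @ideal_gen_ideal R (range x).
  (* In [R] the lifted parameters only give [m^n] inside [(x) + inf]; as [inf] lies in [m^(n+1)],
     Nakayama removes it. *)
  exists n; apply: nakayama => //; first exact: fin_gen_pow.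
  rewrite -ideal_powS => a ma; have [b Gb Eb] : (phi @` ideal_gen (range x)) (phi a).
    by apply: H; exists a.
  exists b, (a - b); split=> //; last by rewrite addrC subrK.
  suff : inf (a - b) by apply.
  by rewrite -to_completion_ker /preimage /= (phiB phiD) Eb subrr.
by have [d'] := cdim_params mx mX; rewrite E => -[<-].
Qed.

End CompletionMap.

(** * The invariants of the ultraproduct in terms of the dimension of the components *)

Section UltraDimensions.
Variables (W : Type) (U : set_system W) (HU : UltraFilter U) (R : W -> localRing).
Hypothesis R_noetherian : forall w, noetherian (R w).
Local Notation P := (ultra_prod HU R).
Local Notation Rn := (ultraproduct HU R).
Local Notation cls := (@ultra_class W U HU R).

Lemma krull_dim_near : (exists b : nat, \forall w \near U, enat_le (embdim (R w)) (Some b)) ->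
  exists d, \forall w \near U, krull_dim (R w) = Some d.
Proof.
move=> /ultra_bounded_gen[n Hn]; apply: (near_bounded HU (n := n)).
apply: filterS Hn => w [x mE].
have [||d E dn] := @krull_dim_params (R w) n x 1 (@R_noetherian w).
- by move=> i; rewrite mE; apply: ideal_gen_range.
- by rewrite -mE ideal_pow1 //; apply: maxid_ideal.
- by exists d.
Qed.

Variable d : nat.
Hypothesis dim_near : \forall w \near U, krull_dim (R w) = Some d.

Lemma udim_eq : udim U R = Some d.
Proof.
apply: xget_unique => // y Hy.
by have [w [<- ]] := filter_ex (filterI Hy dim_near).
Qed.

Lemma ultra_gen n (x : 'I_n -> Rn) : exists g : 'I_n -> P,
  x = (fun i => cls (g i)) /\
  ideal_gen (range x) = uset HU (fun w => ideal_gen (range (fun i => g i w))).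
Proof.
have [g Hg] := ultra_surj_fun x; exists g.
have -> : x = fun i => cls (g i) by apply/funext.
by rewrite uset_gen.
Qed.

Lemma ultra_colon_gen n (g : 'I_n -> P) b : colon (ideal_gen (range (fun i => cls (g i)))) (cls b)
  = uset HU (fun w => colon (ideal_gen (range (fun i => g i w))) (b w)).
Proof. by rewrite uset_gen uset_colon. Qed.

(** The competing primes [(J : b)] are internal, so one properly below the maximal ideal would be so
    in almost all components, where the maximal ideal is minimal over the [d] parameters. *)
Lemma params_minimal_associated : exists2 J : set Rn,
  generated_by d J & minimal_associated_prime J (maxid Rn).
Proof.
have [|f Hf] := @near_choice W U HU (fun w => (('I_d -> R w) * R w)%type) (fun=> (fun=> 0, 0))
  (fun w x => minimal_over (ideal_gen (range x.1)) (maxid (R w)) /\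
     maxid (R w) = colon (ideal_gen (range x.1)) x.2).
  apply: filterS dim_near => w /(params_exist (@R_noetherian w))[x mx minx].
  have [a Ea] := minimal_over_colon (@R_noetherian w) (@ideal_gen_ideal _ _) minx.
  by exists (x, a).
pose g (i : 'I_d) : P := fun w => (f w).1 i.
exists (ideal_gen (range (fun i => cls (g i)))); first by exists (fun i => cls (g i)).
split.
  split; first exact: maxid_prime.
  exists (cls (fun w => (f w).2)); rewrite ultra_colon_gen -uset_maxid.
  by apply: uset_eq; apply: filterS Hf => w [].
move=> Q [PQ [b EQ]]; rewrite EQ in PQ *; have [b' Eb] := ultra_surj b.
rewrite Eb ultra_colon_gen -uset_maxid in PQ * => /uset_proper lt.
have IQ : \forall w \near U, ideal (colon (ideal_gen (range (fun i => g i w))) (b' w)).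
  by apply: nearW => w; apply: colon_ideal; apply: ideal_gen_ideal.
move/(uset_prime HU IQ) : PQ => PQ.
have [w [[Pw [sw nsw]] [[_ _ minw] _]]] := filter_ex (filterI (filterI PQ lt) Hf).
by apply: nsw; apply: minw => //; apply: colon_sub; apply: ideal_gen_ideal.
Qed.

(** If [k < d], the height theorem leaves in almost all components a prime other than the maximal
    ideal over the [k] generators, and [colon_prime] finds an associated prime [(J_w : b_w)] inside
    it. The class of the [b_w] makes the ultraproduct of these an associated prime of [J] properly
    below the maximal ideal. *)
Lemma minimal_associated_dim k (J : set Rn) : generated_by k J ->
  minimal_associated_prime J (maxid Rn) -> (d <= k)%N.
Proof.
move=> [x ->] [[_ [a mE]] minm]; have [g [Ex _]] := ultra_gen x.
rewrite Ex in mE minm; have [a' Ea] := ultra_surj a.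
rewrite Ea ultra_colon_gen -uset_maxid in mE.
have gm : \forall w \near U, ideal_gen (range (fun i => g i w)) `<=` maxid (R w).
  have /uset_sub : uset HU (fun w => colon (ideal_gen (range (fun i => g i w))) (a' w))
      `<=` uset HU (fun w => maxid (R w)) by rewrite mE.
  apply: filterS => w; apply: subset_trans; apply: colon_sub; exact: ideal_gen_ideal.
apply: contrapT => dk.
have [b Hb] : exists b : P, \forall w \near U,
    let Q := colon (ideal_gen (range (fun i => g i w))) (b w) in
    prime_ideal Q /\ Q `<` maxid (R w).
  apply: (@near_choice W U HU R (fun=> 0) (fun w b =>
    let Q := colon (ideal_gen (range (fun i => g i w))) b in
    prime_ideal Q /\ Q `<` maxid (R w))).
  apply: filterS2 dim_near gm => w /krull_dimP[Hd _] gw.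
  have nmin : ~ minimal_over (ideal_gen (range (fun i => g i w))) (maxid (R w)).
    by move=> minw; apply: dk; apply: krull_height minw Hd.
  have [Q [PQ gQ mQ]] : exists Q : set (R w), [/\ prime_ideal Q,
      ideal_gen (range (fun i => g i w)) `<=` Q & ~ maxid (R w) `<=` Q].
    apply: contrapT => /forallNP no; apply: nmin; split=> //; first exact: maxid_prime.
    by move=> Q PQ gQ _; apply: contrapT => mQ; apply: (no Q).
  have [|s t Qs Qt|s Qs|b [_ Pb Qb]] :=
    @colon_prime (R w) (~` Q) _ 1 (@R_noetherian w) (@ideal_gen_ideal _ (range (fun i => g i w))).
  - exact: prime1.
  - exact: primeNM.
  - by rewrite mulr1 => /gQ.
  exists b; split=> //; split; first exact: prime_sub_maxid.
  by move=> s; apply: mQ => y my; apply: contrapT => Qy; apply: (Qb y) => //; apply: s.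
pose Q := uset HU (fun w => colon (ideal_gen (range (fun i => g i w))) (b w)).
apply: (minm Q).
  split; last by exists (cls b); rewrite ultra_colon_gen.
  apply/uset_prime; last by apply: filterS Hb => w [].
  by apply: nearW => w; apply: colon_ideal; apply: ideal_gen_ideal.
by rewrite -uset_maxid; apply/uset_proper; apply: filterS Hb => w [].
Qed.

Lemma pidim_eq : pidim Rn = Some d.
Proof.
apply: enat_min_eq; first exact: params_minimal_associated.
by move=> k [J]; apply: minimal_associated_dim.
Qed.

Lemma ultra_finitely_related (I : forall w, set (R w)) : (\forall w \near U,
    exists (x : 'I_d -> R w) a, I w = colon (ideal_gen (range x)) a) ->
  finitely_related (uset HU I).
Proof.
move=> H.
have [|f Hf] := @near_choice W U HU (fun w => (('I_d -> R w) * R w)%type) (fun=> (fun=> 0, 0))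
    (fun w x => I w = colon (ideal_gen (range x.1)) x.2).
  by apply: filterS H => w [x [a E]]; exists (x, a).
pose g (i : 'I_d) : P := fun w => (f w).1 i.
exists (ideal_gen (range (fun i => cls (g i)))), (cls (fun w => (f w).2)).
by split; [exact: fin_gen_gen | rewrite ultra_colon_gen; apply: uset_eq].
Qed.

Lemma finitely_related_ultra (I : set Rn) : finitely_related I ->
  exists J : forall w, set (R w), (forall w, ideal (J w)) /\ I = uset HU J.
Proof.
move=> [J [a [[n [x ->]] ->]]]; have [g [-> _]] := ultra_gen x.
have [b ->] := ultra_surj a; rewrite ultra_colon_gen.
exists (fun w => colon (ideal_gen (range (fun i => g i w))) (b w)); split=> // w.
by apply: colon_ideal; apply: ideal_gen_ideal.
Qed.

(** All primes of a component have height at most [d], so those of a longest chain are colons of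
    ideals with [d] generators each. Noetherianity alone would not bound this number independently
    of [w], and the ultraproducts might fail to be finitely related. *)
Lemma frdim_chain : prime_chain (@finitely_related Rn) d.
Proof.
have [|p Hp] := @near_choice W U HU (fun w => nat -> set (R w)) (fun w _ => set0)
  (fun w p => (forall i, (i < d.+1)%N -> prime_ideal (p i) /\
      exists (x : 'I_d -> R w) a, p i = colon (ideal_gen (range x)) a) /\
    (forall i, (i < d)%N -> p i `<` p i.+1)).
  apply: filterS dim_near => w /krull_dimP[Hd dmax].
  have [p [Pp plt pd]] := height_chain Hd.
  exists p; split=> // i; rewrite ltnS => ilt; split; first exact: Pp.
  have [|x px minx] := @minimal_over_params _ (p i) d (@R_noetherian w) (Pp i ilt).
    move=> n Hn; apply: dmax; apply: height_geS Hn; first exact: maxid_prime.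
    exact: prime_sub_maxid (Pp i ilt).
  have [a Ea] := minimal_over_colon (@R_noetherian w) (@ideal_gen_ideal _ _) minx.
  by exists x, a.
exists (fun i => uset HU (fun w => p w i)); split=> i ilt.
  have Pi : \forall w \near U, prime_ideal (p w i).
    by apply: filterS Hp => w [H _]; have [] := H i ilt.
  split; last first.
    by apply: ultra_finitely_related; apply: filterS Hp => w [H _]; have [] := H i ilt.
  by apply/uset_prime => //; apply: filterS Pi => w /prime_idealW.
by apply/uset_proper; apply: filterS Hp => w [_]; apply.
Qed.

Lemma frdim_bound k : prime_chain (@finitely_related Rn) k -> (k <= d)%N.
Proof.
move=> [p [Hp plt]].
have /choice[I HI] i : exists I : forall w, set (R w), (i <= k)%N ->
    (forall w, ideal (I w)) /\ p i = uset HU I.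
  have [ik|ki] := boolP (i <= k)%N; last by exists (fun=> set0).
  by have [_ /finitely_related_ultra[J HJ]] := Hp i ik; exists J.
have H1 : \forall w \near U, forall i, (i < k.+1)%N -> prime_ideal (I i w).
  apply: near_forall_ltn => i ik; have [Ii E] := HI i ik.
  by apply/(uset_prime HU (nearW _ Ii)); rewrite -E; have [] := Hp i ik.
have H2 : \forall w \near U, forall i, (i < k)%N -> I i w `<` I i.+1 w.
  apply: near_forall_ltn => i ik; have [_ E] := HI i (ltnW ik); have [_ E'] := HI _ ik.
  by apply/(uset_proper HU); rewrite -E -E'; apply: plt.
have [w [/krull_dimP[_ dmax] [Pw ltw]]] := filter_ex (filterI dim_near (filterI H1 H2)).
apply: dmax; apply: (@prime_chain_height _ (fun=> True)).
by exists (fun i => I i w); split=> // i ik; split=> //; apply: Pw.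
Qed.

Lemma frdim_eq : frdim Rn = Some d.
Proof. by apply: enat_sup_eq; [exact: frdim_chain | exact: frdim_bound]. Qed.

Lemma ultra_koszul_d n (g : 'I_n -> P) (c : {set 'I_n} -> P) S :
  koszul_d (fun i => cls (g i)) [ffun T => cls (c T)] S =
  cls (fun w => koszul_d (fun i => g i w) [ffun T => c T w] S).
Proof.
rewrite koszul_dE.
have E j : koszul_sign Rn S j * cls (g j) * [ffun T => cls (c T)] (j |: S)%SET =
    cls (fun w => koszul_sign (R w) S j * g j w * [ffun T => c T w] (j |: S)%SET).
  rewrite ffunE.
  have -> : koszul_sign Rn S j = cls (fun w => koszul_sign (R w) S j).
    rewrite /koszul_sign; elim: #|_| => [|k IH].
      rewrite expr0 -(quot_pi1 (almost_zero_pideal HU R)).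
      by apply/ultra_eq; apply: nearW => w; rewrite expr0.
    rewrite exprS IH -(quot_pi1 (almost_zero_pideal HU R)) -sub0r.
    rewrite -(quot_pi0 (almost_zero_pideal HU R)) -quot_piB -quot_piM.
    apply/ultra_eq; apply: nearW => w; rewrite exprS; congr (_ * _); exact: sub0r.
  rewrite -!quot_piM; apply/ultra_eq; apply: nearW => w.
  by rewrite ffunE.
rewrite (eq_bigr _ (fun j _ => E j)) -ultra_sum; apply/ultra_eq; apply: nearW => w.
by rewrite ultra_sumE koszul_dE.
Qed.

Lemma ultra_koszul_homology n (g : 'I_n -> P) i :
  (\forall w \near U, koszul_homology_neq0 (fun i => g i w) i) ->
  koszul_homology_neq0 (fun i => cls (g i)) i.
Proof.
move=> H.
have [|c Hc] := @near_choice W U HU (fun w => {ffun {set 'I_n} -> R w}) (fun=> 0)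
    (fun w c => koszul_cycle (fun i => g i w) i c /\ ~ koszul_boundary (fun i => g i w) i c).
  by apply: filterS H => w [c]; exists c.
pose c' (S : {set 'I_n}) : P := fun w => c w S.
have cE w : [ffun T => c' T w] = c w by apply/ffunP => T; rewrite ffunE.
exists [ffun S => cls (c' S)]; split; first split.
- move=> S; rewrite ffunE => /eqP; apply: contra_notP => Si.
  rewrite -(quot_pi0 (almost_zero_pideal HU R)); apply/ultra_eq.
  apply: filterS Hc => w [[dc _] _]; apply/eqP; apply: contra_notT Si => /dc //.
- apply/ffunP => S; rewrite ultra_koszul_d [RHS]ffunE.
  rewrite -(quot_pi0 (almost_zero_pideal HU R)); apply/ultra_eq.
  by apply: filterS Hc => w [[_ dc] _]; rewrite cE dc ffunE.
- move=> [b db E].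
  have [b0 Hb0] := ultra_surj_fun b.
  (* Coordinates of [b] outside degree [i + 1] vanish only in [Rn]; cutting the representatives
     makes them homogeneous in every component. *)
  pose b' (S : {set 'I_n}) : P := fun w => if #|S| == i.+1 then b0 S w else 0.
  have bE : b = [ffun S => cls (b' S)].
    apply/ffunP => S; rewrite ffunE /b'; case: eqP => [_|Si]; first by rewrite Hb0.
    have -> : b S = 0 by apply: contra_notP Si => /eqP/db.
    by rewrite -(quot_pi0 (almost_zero_pideal HU R)).
  have near_b (S : {set 'I_n}) : \forall w \near U, c w S = koszul_d (fun i => g i w) [ffun T => b' T w] S.
    by apply/ultra_eq; rewrite -ultra_koszul_d -bE -E ffunE.
  have [w [[_ nb] bw]] := filter_ex (filterI Hc (filter_forall _ near_b)).
  apply: nb; exists [ffun T => b' T w]; last by apply/ffunP.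
  by move=> S; rewrite ffunE /b'; case: (#|S| =P i.+1) => // _; rewrite eqxx.
Qed.

(** Homological degrees are bounded by [n], so almost all components have nonzero homology in one
    common degree [i] with [n <= i + d]. It survives in [Rn], whence [i <= h]. The default value 0
    of [depth] is harmless here. *)
Lemma depth_le : (depth Rn <= d)%N.
Proof.
rewrite /depth; case: xgetP => [_ _ [n [x [h [mE _ hmax ->]]]]|//].
have [g [Ex _]] := ultra_gen x; rewrite Ex in mE hmax.
have mEw : \forall w \near U, maxid (R w) = ideal_gen (range (fun i => g i w)).
  have /seteqP[/uset_sub s1 /uset_sub s2] : uset HU (fun w => maxid (R w)) =
      uset HU (fun w => ideal_gen (range (fun i => g i w))).
    by rewrite uset_maxid mE uset_gen.
  by apply: filterS2 s1 s2 => w ? ?; apply/seteqP.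
have [|i Hi] := @near_bounded _ _ HU n (fun i w => (n <= i + d)%N /\
    koszul_homology_neq0 (fun j => g j w) i).
  apply: filterS2 mEw dim_near => w Ew dw.
  have [i ni Hi] := koszul_homology_dim (@R_noetherian w) Ew dw.
  by exists i => //; apply: koszul_homology_degree Hi.
have [_ [ni _]] := filter_ex Hi.
rewrite leq_subLR; apply: leq_trans ni _; rewrite leq_add2r; apply: hmax.
by apply: ultra_koszul_homology; apply: filterS Hi => w [].
Qed.

Hypothesis m_fin_gen : fin_gen (maxid Rn).

(** The exponent [n] of an inclusion of [m^n] in [(x)] is the same in almost all components, where
    Krull's height theorem bounds the dimension by [e]. *)
Lemma udim_gdim e : gdim Rn = Some e -> (d <= e)%N.
Proof.
move=> /enat_min_some[/(gdim_set m_fin_gen)[x [mx [n mX]]] _].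
have [g [Ex Eg]] := ultra_gen x.
have : ideal_gen (range x) `<=` maxid Rn.
  by apply: ideal_gen_range_sub => //; apply: maxid_ideal.
move: mX; rewrite Eg -uset_maxid (uset_pow n m_fin_gen) => /uset_sub mXw /uset_sub gm.
have [w [dw [mw gw]]] := filter_ex (filterI dim_near (filterI mXw gm)).
have [|d'] := @krull_dim_params (R w) e (fun i => g i w) n (@R_noetherian w) _ mw.
  by move=> i; apply: gw; apply: (@ideal_gen_range _ e (fun i => g i w)).
by rewrite dw => -[<-].
Qed.

End UltraDimensions.

Theorem theorem5p18 (W : Type) (U : set_system W) (HU : UltraFilter U)
  (W_infinite : infinite_set [set: W])
  (U_nonprincipal : nonprincipal U)
  (U_incomplete : countably_incomplete U)
  (R : W -> localRing)
  (R_noetherian : forall w, noetherian (R w))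
  (R_bounded : exists b : nat,
     \forall w \near U, enat_le (embdim (R w)) (Some b)) :
  let Rn := ultraproduct HU R in
  enat_le (Some (depth Rn)) (pidim Rn) /\
  pidim Rn = frdim Rn /\
  frdim Rn = udim U R /\
  enat_le (udim U R) (cldim Rn) /\
  cldim Rn = gdim Rn /\
  gdim Rn = cdim Rn /\
  enat_le (cdim Rn) (embdim Rn).
Proof.
move=> Rn; have [d dim_near] := krull_dim_near HU R_noetherian R_bounded.
have fm := ultra_maxid_fin_gen HU R_bounded.
have lim := @cauchy_limit _ _ HU _ R_bounded U_incomplete.
have clo := @fin_gen_closure _ _ HU _ R_bounded U_incomplete.
have cld := cldim_cdim fm lim clo; have gd := gdim_cdim fm lim clo.
have [e cde cdle] := cdim_embdim fm lim clo.
rewrite (pidim_eq HU R_noetherian dim_near) (frdim_eq HU R_noetherian dim_near).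
rewrite (udim_eq HU dim_near) cld gd; split; first exact: depth_le.
do 3!split=> //; first by rewrite cde; apply: (udim_gdim R_noetherian dim_near fm); rewrite gd.
Qed.
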